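(* The incidence Hopf algebra $H(\mathcal{F})$ of the family of intervals of the pointed partition posets of type $A$ is isomorphic to the Hopf algebra structure on the polynomial algebra in the variables $(a_n)_{n\ge 2}$ given by the composition of formal power series of the shape $$x+\sum_{n\ge 2}a_n\frac{x^n}{(n-1)!}.$$
   Context: Pointed partition posets: a pointed partition of $[n]=\{1,\dots,n\}$ is a partition of $[n]$ into non-empty blocks together with the choice of one (pointed) element in each block. The poset $\Pi^A_n$ is the set of all pointed partitions of $[n]$, with $\pi\le\nu$ iff the underlying partition of $\pi$ refines that of $\nu$ and the set of pointed elements of $\pi$ contains that of $\nu$. All intervals $[\hat 0,\alpha]$ with $\alpha$ a maximal element (one block, one pointed element) are isomorphic and denoted $\Pi^A_{n,1}$. Incidence Hopf algebra: $\mathcal{F}$ is the set of isomorphism classes of all intervals in all posets $\Pi^A_n$, $n\ge1$; it is closed under products and taking subintervals, and representatives are the (possibly empty) finite products of the posets $\Pi^A_{n,1}$, $n\ge2$. $H(\mathcal{F})$ is the vector space (over a field of characteristic $0$) with basis $\mathcal{F}$, with product $[P][Q]=[P\times Q]$, unit the class of the one-element poset, coproduct $\Delta[P]=\sum_{\pi\in P}[\hat 0,\pi]\otimes[\pi,\hat 1]$ (classes of the subintervals of $P$) and counit equal to $1$ on the one-element class and $0$ on other classes. As an algebra it is the polynomial algebra on the classes of $\Pi^A_{n,1}$, $n\geq 2$. Hopf algebra given by composition: on the polynomial algebra in $(a_n)_{n\ge2}$, with $a_1=1$, the coproduct is the algebra morphism such that, writing $F^{(1)}(x)=x+\sum_{n\ge2}(a_n\otimes1)\frac{x^n}{(n-1)!}$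 and $F^{(2)}(x)=x+\sum_{n\ge2}(1\otimes a_n)\frac{x^n}{(n-1)!}$, one has $x+\sum_{n\ge2}\Delta(a_n)\frac{x^n}{(n-1)!}=F^{(2)}(F^{(1)}(x))$. *)

(* Defs.v *)
From HB Require Import structures.
From mathcomp Require Import all_boot all_order all_algebra.
From mathcomp Require Import generic_quotient.
From mathcomp Require Import finmap.
From mathcomp.multinomials Require Import monalg.

Set Implicit Arguments.
Unset Strict Implicit.
Unset Printing Implicit Defensive.

Import Order.TTheory GRing.Theory.

Local Open Scope ring_scope.

(* The set [n] is 'I_n.  Choosing one element in each block of a partition    *)
(* amounts to choosing a transversal of it, the set of pointed elements.      *)

Section PointedPartitions.
Variable n : nat.

Record ppart := PPart {
  pp_data : {set {set 'I_n}} * {set 'I_n};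
  _ : is_transversal pp_data.2 pp_data.1 [set: 'I_n]
}.

HB.instance Definition _ := [isSub for pp_data].
HB.instance Definition _ := [Finite of ppart by <:].

Definition blocks (x : ppart) : {set {set 'I_n}} := (val x).1.
Definition points (x : ppart) : {set 'I_n} := (val x).2.

Definition pp_le (x y : ppart) : bool :=
  [forall B in blocks x, [exists C in blocks y, B \subset C]]
  && (points y \subset points x).

Lemma pp_transversal x : is_transversal (points x) (blocks x) [set: 'I_n].
Proof. exact: valP x. Qed.

Lemma pp_partition x : partition (blocks x) [set: 'I_n].
Proof. by case/and3P: (pp_transversal x). Qed.

Lemma pp_trivIset x : trivIset (blocks x).
Proof. by case/and3P: (pp_partition x). Qed.

Lemma mem_pp_pblock x i : i \in pblock (blocks x) i.
Proof.
by rewrite mem_pblock; case/and3P: (pp_partition x) => /eqP-> _ _; rewrite inE.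
Qed.

Lemma pp_pblock_mem x i : pblock (blocks x) i \in blocks x.
Proof.
by apply: pblock_mem; case/and3P: (pp_partition x) => /eqP-> _ _; rewrite inE.
Qed.

(* pt x i is the pointed element of the block of i. *)
Definition pt (x : ppart) (i : 'I_n) : 'I_n :=
  transversal_repr i (points x) (pblock (blocks x) i).

Lemma pt_block x i : pt x i \in pblock (blocks x) i.
Proof. exact: (repr_mem_pblock (pp_transversal x)) (pp_pblock_mem x i). Qed.

Lemma pt_point x i : pt x i \in points x.
Proof. exact: (repr_mem_transversal (pp_transversal x)) (pp_pblock_mem x i). Qed.

Lemma pblock_pt x i : pblock (blocks x) (pt x i) = pblock (blocks x) i.
Proof. exact: same_pblock (pp_trivIset x) (pt_block x i). Qed.

Lemma point_pt x i : (i \in points x) = (pt x i == i).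
Proof.
apply/idP/eqP => [ix|<-]; last exact: pt_point.
exact: (pblockK (pp_transversal x)).
Qed.

Lemma ptK x i : pt x (pt x i) = pt x i.
Proof. by apply/eqP; rewrite -point_pt pt_point. Qed.

Lemma pblock_ptE x i j : (j \in pblock (blocks x) i) = (pt x i == pt x j).
Proof.
apply/idP/eqP => [ji|eqij].
  have e := same_pblock (pp_trivIset x) ji.
  have [y yp] : exists y, y \in points x /\ pblock (blocks x) i = pblock (blocks x) y.
    by exists (pt x i); rewrite pt_point pblock_pt.
  have h k : pblock (blocks x) k = pblock (blocks x) y -> pt x k = y.
    by rewrite /pt => ->; apply: (pblockK (pp_transversal x) _ yp.1).
  by rewrite (h i yp.2) (h j) // e yp.2.
by rewrite -(pblock_pt x i) eqij pblock_pt mem_pp_pblock.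
Qed.

Lemma blocksE x : blocks x = [set [set j | pt x i == pt x j] | i : 'I_n].
Proof.
have blkE i : [set j | pt x i == pt x j] = pblock (blocks x) i.
  by apply/setP => j; rewrite inE pblock_ptE.
apply/setP => B; apply/idP/imsetP => [Bx|[i _ ->]]; last first.
  by rewrite blkE pp_pblock_mem.
have [i iB] : exists i, i \in B.
  apply/set0Pn; case/and3P: (pp_partition x) => _ _.
  by apply: contraNneq => <-.
by exists i => //; rewrite blkE (def_pblock (pp_trivIset x) Bx iB).
Qed.

Lemma pt_inj x y : pt x =1 pt y -> x = y.
Proof.
move=> e; apply/val_inj; rewrite [LHS]surjective_pairing [RHS]surjective_pairing.
congr (_, _); last by apply/setP => i; rewrite [LHS]point_pt [RHS]point_pt e.
rewrite [LHS]blocksE [RHS]blocksE; apply: eq_imset => i.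
by apply/setP => j; rewrite !inE !e.
Qed.

Lemma pp_leP x y :
  reflect (forall i, pt y (pt x i) = pt y i /\ pt x (pt y i) = pt y i) (pp_le x y).
Proof.
apply: (iffP andP) => [[/forall_inP ref sub] i|h].
  split; last by apply/eqP; rewrite -point_pt (subsetP sub) // pt_point.
  have /exists_inP[C Cy sBC] := ref _ (pp_pblock_mem x i).
  apply/esym/eqP; rewrite -pblock_ptE.
  rewrite (def_pblock (pp_trivIset y) Cy (subsetP sBC _ (mem_pp_pblock x i))).
  exact: subsetP sBC _ (pt_block x i).
split; last first.
  by apply/subsetP => i; rewrite !point_pt => /eqP e; rewrite -{1}e (h i).2 e.
apply/forall_inP => B; rewrite blocksE => /imsetP[i _ ->].
apply/exists_inP; exists (pblock (blocks y) i); first exact: pp_pblock_mem.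
apply/subsetP => j; rewrite inE pblock_ptE => /eqP e.
by rewrite -(h i).1 e (h j).1.
Qed.

Fact pp_le_refl : reflexive pp_le.
Proof. by move=> x; apply/pp_leP => i; rewrite ptK. Qed.

Fact pp_le_anti : antisymmetric pp_le.
Proof.
move=> x y /andP[/pp_leP xy /pp_leP yx]; apply: pt_inj => i.
by rewrite -(yx i).1 (xy i).2.
Qed.

Fact pp_le_trans : transitive pp_le.
Proof.
move=> y x z /pp_leP xy /pp_leP yz; apply/pp_leP => i; split.
  by rewrite -(yz (pt x i)).1 (xy i).1 (yz i).1.
by rewrite -(yz i).2 (xy (pt z i)).2.
Qed.

Fact pp_display : Order.disp_t. Proof. exact: Order.Disp tt tt. Qed.

HB.instance Definition _ :=
  Order.Le_isPOrder.Build pp_display ppart pp_le_refl pp_le_anti pp_le_trans.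

Lemma pp_leE (x y : ppart) : (x <= y)%O = pp_le x y.
Proof. by []. Qed.

Section OfIdempotent.
Variable f : 'I_n -> 'I_n.
Hypothesis fK : forall i, f (f i) = f i.

Lemma idem_pblock i j :
  (j \in pblock (preim_partition f [set: 'I_n]) i) = (f i == f j).
Proof.
apply: pblock_equivalence_partition; rewrite ?inE // => a b c _ _ _.
by split=> // /eqP->.
Qed.

Lemma idem_transversal :
  is_transversal [set i | f i == i] (preim_partition f [set: 'I_n]) [set: 'I_n].
Proof.
have pP := preim_partitionP f [set: 'I_n].
have tP : trivIset (preim_partition f [set: 'I_n]) by case/and3P: pP.
apply/and3P; split; rewrite ?subsetT //.
apply/forall_inP => B BP.
have [i iB] : exists i, i \in B.
  by apply/set0Pn; case/and3P: pP => _ _; apply: contraNneq => <-.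
apply/cards1P; exists (f i); apply/setP => j; rewrite !inE.
rewrite -(def_pblock tP BP iB) idem_pblock.
apply/andP/eqP => [[/eqP fj /eqP ->]//|->].
by rewrite !fK !eqxx.
Qed.

Definition pp_of_idem : ppart := @PPart (_, _) idem_transversal.

Lemma pt_of_idem i : pt pp_of_idem i = f i.
Proof.
have := pt_block pp_of_idem i; rewrite idem_pblock => /eqP ->.
by have := pt_point pp_of_idem i; rewrite inE => /eqP.
Qed.
End OfIdempotent.

Definition pp_bot : ppart := pp_of_idem (fun i => erefl i).
End PointedPartitions.

(* Closed intervals [lo, hi] of the posets Pi_n, n >= 1. *)
Definition interval : Type :=
  {n : nat & {ab : ppart n.+1 * ppart n.+1 | (ab.1 <= ab.2)%O}}.
HB.instance Definition _ := Choice.on interval.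

Definition Itv n (a b : ppart n.+1) (ab : (a <= b)%O) : interval :=
  existT _ n (exist _ (a, b) ab).

Definition itv_dim (I : interval) : nat := (projT1 I).+1.
Definition lo (I : interval) : ppart (itv_dim I) := (val (projT2 I)).1.
Definition hi (I : interval) : ppart (itv_dim I) := (val (projT2 I)).2.

Lemma lo_le_hi I : (lo I <= hi I)%O. Proof. exact: valP (projT2 I). Qed.

Section Elements.
Variable I : interval.

Record elts := Elt {
  elt_val : ppart (itv_dim I);
  _ : (lo I <= elt_val <= hi I)%O
}.
HB.instance Definition _ := [isSub for elt_val].
HB.instance Definition _ := [Finite of elts by <:].
HB.instance Definition _ :=
  [SubChoice_isSubPOrder of elts by <: with pp_display].

Lemma ge_lo (x : elts) : (lo I <= val x)%O. Proof. by case/andP: (valP x). Qed.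
Lemma le_hi (x : elts) : (val x <= hi I)%O. Proof. by case/andP: (valP x). Qed.

(* The subintervals [lo, x] and [x, hi]. *)
Definition lower (x : elts) : interval := Itv (ge_lo x).
Definition upper (x : elts) : interval := Itv (le_hi x).
End Elements.

Section Isomorphism.
Variables (d d' : Order.disp_t).

Definition poset_iso (T : finPOrderType d) (T' : finPOrderType d') : bool :=
  [exists f : {ffun T -> T'}, [&& injectiveb f, [forall y, exists x, f x == y] &
    [forall x, forall y, (f x <= f y)%O == (x <= y)%O]]].

Lemma poset_isoP (T : finPOrderType d) (T' : finPOrderType d') :
  reflect (exists2 f : T -> T', bijective f & {mono f : x y / (x <= y)%O})
          (poset_iso T T').
Proof.
apply: (iffP existsP) => [[f /and3P[/injectiveP fI /forallP fS /forallP fM]]|].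
  exists f => [|x y]; last by apply/eqP; apply: (forallP (fM x)).
  have fS' y : exists x, f x == y by apply/existsP.
  exists (fun y => xchoose (fS' y)) => [x|y]; last exact/eqP/(xchooseP (fS' y)).
  exact/fI/eqP/(xchooseP (fS' (f x))).
case=> f [g fK gK] fM; exists [ffun x => f x]; apply/and3P; split.
- by apply/injectiveP => x y; rewrite !ffunE; apply: can_inj.
- by apply/forallP => y; apply/existsP; exists (g y); rewrite ffunE gK.
- by apply/forallP => x; apply/forallP => y; rewrite !ffunE fM.
Qed.
End Isomorphism.

Lemma poset_iso_refl d (T : finPOrderType d) : poset_iso T T.
Proof. by apply/poset_isoP; exists id => //; exists id. Qed.

Lemma poset_iso_sym d d' (T : finPOrderType d) (T' : finPOrderType d') :
  poset_iso T T' = poset_iso T' T.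
Proof.
by apply/poset_isoP/poset_isoP => -[f [g fK gK] fM];
  exists g; [exists f|move=> x y; rewrite -fM !gK|exists f|move=> x y; rewrite -fM !gK].
Qed.

Lemma poset_iso_trans d1 d2 d3 (T1 : finPOrderType d1) (T2 : finPOrderType d2)
  (T3 : finPOrderType d3) :
  poset_iso T1 T2 -> poset_iso T2 T3 -> poset_iso T1 T3.
Proof.
move=> /poset_isoP[f fB fM] /poset_isoP[g gB gM]; apply/poset_isoP.
by exists (g \o f) => [|x y]; [exact: bij_comp | rewrite /= gM fM].
Qed.

Lemma poset_iso_prod d1 d2 d3 d4 (T1 : finPOrderType d1) (T2 : finPOrderType d2)
  (T3 : finPOrderType d3) (T4 : finPOrderType d4) :
  poset_iso T1 T3 -> poset_iso T2 T4 -> poset_iso (T1 *p T2) (T3 *p T4).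
Proof.
move=> /poset_isoP[f [f' fK fK'] fM] /poset_isoP[g [g' gK gK'] gM].
apply/poset_isoP.
exists (fun x : T1 *p T2 => (f x.1, g x.2) : T3 *p T4).
  exists (fun x : T3 *p T4 => (f' x.1, g' x.2) : T1 *p T2).
    by move=> [x y]; rewrite /= fK gK.
  by move=> [x y]; rewrite /= fK' gK'.
move=> [x y] [z t].
by change ((f x <= f z)%O && (g y <= g t)%O = (x <= z)%O && (y <= t)%O); rewrite fM gM.
Qed.

Lemma poset_iso_prodC d1 d2 (T1 : finPOrderType d1) (T2 : finPOrderType d2) :
  poset_iso (T1 *p T2) (T2 *p T1).
Proof.
apply/poset_isoP; exists (fun x : T1 *p T2 => (x.2, x.1) : T2 *p T1).
  by exists (fun x : T2 *p T1 => (x.2, x.1) : T1 *p T2) => -[].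
move=> [x y] [z t].
by change ((y <= t)%O && (x <= z)%O = (x <= z)%O && (y <= t)%O); rewrite andbC.
Qed.

Lemma poset_iso_prodA d1 d2 d3 (T1 : finPOrderType d1) (T2 : finPOrderType d2)
    (T3 : finPOrderType d3) :
  poset_iso (T1 *p (T2 *p T3)) ((T1 *p T2) *p T3).
Proof.
apply/poset_isoP.
exists (fun x : T1 *p (T2 *p T3) => ((x.1, x.2.1), x.2.2) : (T1 *p T2) *p T3).
  by exists (fun x : (T1 *p T2) *p T3 => (x.1.1, (x.1.2, x.2)) : T1 *p (T2 *p T3));
    [move=> [x [y z]] | move=> [[x y] z]].
move=> [x1 [x2 x3]] [y1 [y2 y3]].
change ([&& (x1 <= y1)%O && (x2 <= y2)%O & (x3 <= y3)%O] =
        [&& (x1 <= y1)%O, (x2 <= y2)%O & (x3 <= y3)%O]).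
by rewrite andbA.
Qed.

Lemma poset_iso_prod1 d1 d2 (T1 : finPOrderType d1) (T2 : finPOrderType d2) :
  #|T1| = 1%N -> poset_iso (T1 *p T2) T2.
Proof.
move=> /eqP/card1P[t tE]; have tE' x : x = t by apply/eqP; rewrite -[_ == _]tE.
apply/poset_isoP; exists (fun x : T1 *p T2 => x.2).
  exists (fun y : T2 => (t, y) : T1 *p T2) => // -[x y] /=.
  by rewrite (tE' x).
move=> [x y] [z u]; rewrite (tE' x) (tE' z).
by change ((y <= u)%O = (t <= t)%O && (y <= u)%O); rewrite lexx.
Qed.

Lemma poset_iso_card d d' (T : finPOrderType d) (T' : finPOrderType d') :
  poset_iso T T' -> #|T| = #|T'|.
Proof. by move=> /poset_isoP[f fB _]; apply: bij_eq_card fB. Qed.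

Lemma poset_iso_one d d' (T : finPOrderType d) (T' : finPOrderType d') :
  #|T| = 1%N -> #|T'| = 1%N -> poset_iso T T'.
Proof.
move=> /eqP/card1P[t tE] /eqP/card1P[t' tE'].
have {}tE x : x = t by apply/eqP; rewrite -[_ == _]tE.
have {}tE' x : x = t' by apply/eqP; rewrite -[_ == _]tE'.
apply/poset_isoP; exists (fun => t') => [|x y]; last by rewrite (tE x) (tE y) !lexx.
by exists (fun => t) => x; rewrite ?(tE x) ?(tE' x).
Qed.

(* Closure of the family of intervals under products: [a, b] x [c, d] is      *)
(* isomorphic to [a + c, b + d], where + is the disjoint union of pointed     *)
(* partitions.                                                                *)
Section DisjointUnion.
Variables m n : nat.

Definition sum_fun (f : 'I_m -> 'I_m) (g : 'I_n -> 'I_n) (i : 'I_(m + n)) :=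
  match split i with inl j => lshift n (f j) | inr j => rshift m (g j) end.

Lemma sum_funl f g j : sum_fun f g (lshift n j) = lshift n (f j).
Proof. by rewrite /sum_fun (unsplitK (inl j)). Qed.

Lemma sum_funr f g j : sum_fun f g (rshift m j) = rshift m (g j).
Proof. by rewrite /sum_fun (unsplitK (inr j)). Qed.

Definition sum_funE := (sum_funl, sum_funr).

Lemma sum_ptK x y i : sum_fun (pt x) (pt y) (sum_fun (pt x) (pt y) i) =
  sum_fun (pt x) (pt y) i.
Proof. by case: (split_ordP i) => j ->; rewrite !sum_funE ptK. Qed.

Definition pp_sum (x : ppart m) (y : ppart n) : ppart (m + n) :=
  pp_of_idem (sum_ptK x y).

Lemma pt_suml x y j : pt (pp_sum x y) (lshift n j) = lshift n (pt x j).
Proof. by rewrite pt_of_idem sum_funE. Qed.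

Lemma pt_sumr x y j : pt (pp_sum x y) (rshift m j) = rshift m (pt y j).
Proof. by rewrite pt_of_idem sum_funE. Qed.

Definition pt_sumE := (pt_suml, pt_sumr).

Lemma le_pp_sum x x' y y' :
  (pp_sum x y <= pp_sum x' y')%O = (x <= x')%O && (y <= y')%O.
Proof.
rewrite !pp_leE; apply/pp_leP/andP => [h|[/pp_leP hx /pp_leP hy] i].
  split; apply/pp_leP => j.
    have := h (lshift n j); rewrite !pt_sumE.
    by move=> [/lshift_inj-> /lshift_inj->].
  have := h (rshift m j); rewrite !pt_sumE.
  by move=> [/rshift_inj-> /rshift_inj->].
case: (split_ordP i) => j ->; rewrite !pt_sumE; first by rewrite (hx j).1 (hx j).2.
by rewrite (hy j).1 (hy j).2.
Qed.

(* Everything below a disjoint union is one. *)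
Lemma le_pp_sumP (z : ppart (m + n)) x y : (z <= pp_sum x y)%O ->
  exists x' y', z = pp_sum x' y'.
Proof.
rewrite pp_leE => /pp_leP h.
have hl j : exists k, pt z (lshift n j) == lshift n k.
  have := (h (lshift n j)).1; case: (split_ordP (pt z (lshift n j))) => k ->.
    by exists k.
  by rewrite !pt_sumE => /eqP; rewrite eq_rlshift.
have hr j : exists k, pt z (rshift m j) == rshift m k.
  have := (h (rshift m j)).1; case: (split_ordP (pt z (rshift m j))) => k ->.
    by rewrite !pt_sumE => /eqP; rewrite eq_lrshift.
  by exists k.
pose f j := xchoose (hl j); pose g j := xchoose (hr j).
have fE j : pt z (lshift n j) = lshift n (f j) by apply/eqP/(xchooseP (hl j)).
have gE j : pt z (rshift m j) = rshift m (g j) by apply/eqP/(xchooseP (hr j)).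
have fK j : f (f j) = f j by apply: (@lshift_inj m n); rewrite -!fE ptK.
have gK j : g (g j) = g j by apply: (@rshift_inj m n); rewrite -!gE ptK.
exists (pp_of_idem fK), (pp_of_idem gK); apply: pt_inj => i.
by case: (split_ordP i) => j ->; rewrite pt_sumE pt_of_idem ?fE ?gE.
Qed.

Lemma pp_sum_inj x x' y y' : pp_sum x y = pp_sum x' y' -> x = x' /\ y = y'.
Proof.
move=> e; split; apply: pt_inj => j.
  by apply: (@lshift_inj m n); rewrite -(pt_suml x y) e pt_suml.
by apply: (@rshift_inj m n); rewrite -(pt_sumr x y) e pt_sumr.
Qed.
End DisjointUnion.

Lemma itv_prod_closed (I J : interval) :
  exists K : interval, poset_iso (elts K) (elts I *p elts J).
Proof.
case: I J => [m [[a b] /= ab]] [n [[c d] /= cd]].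
rewrite -/(Itv ab) -/(Itv cd).
have abcd : (pp_sum a c <= pp_sum b d)%O by rewrite le_pp_sum ab cd.
exists (@Itv (m + n.+1) _ _ abcd); rewrite poset_iso_sym; apply/poset_isoP.
have inK (x : elts (Itv ab)) (y : elts (Itv cd)) :
    (pp_sum a c <= pp_sum (val x) (val y) <= pp_sum b d)%O.
  by rewrite !le_pp_sum (ge_lo x) (ge_lo y) (le_hi x) (le_hi y).
pose f (z : elts (Itv ab) *p elts (Itv cd)) : elts (@Itv (m + n.+1) _ _ abcd) :=
  @Elt (@Itv (m + n.+1) _ _ abcd) _ (inK z.1 z.2).
exists f; last first.
  move=> [x y] [z t].
  change ((pp_sum (val x) (val y) <= pp_sum (val z) (val t))%O =
          (val x <= val z)%O && (val y <= val t)%O).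
  exact: le_pp_sum.
have fI : injective f.
  move=> [x y] [z t] e; have {}e : pp_sum (val x) (val y) = pp_sum (val z) (val t).
    by move: (congr1 (@elt_val _) e) => e'; exact e'.
  have [e1 e2] := pp_sum_inj e.
  by congr (_, _); apply: val_inj.
suff fS z : exists w, f w == z.
  exists (fun z => xchoose (fS z)) => z; last exact/eqP/(xchooseP (fS z)).
  exact/fI/eqP/(xchooseP (fS (f z))).
have [x [y e]] := @le_pp_sumP m.+1 n.+1 (val z) b d (le_hi z).
have : (pp_sum a c <= val z)%O && (val z <= pp_sum b d)%O by exact: valP z.
rewrite e => /andP[].
rewrite (le_pp_sum a x c y) (le_pp_sum x b y d) => /andP[ax cy] /andP[xb yd].
have xin : (a <= x <= b)%O by rewrite ax xb.
have yin : (c <= y <= d)%O by rewrite cy yd.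
by exists (@Elt (Itv ab) x xin, @Elt (Itv cd) y yin); apply/eqP/val_inj.
Qed.

Section SubintervalIso.
Variables (I J : interval) (f : elts I -> elts J) (g : elts J -> elts I).
Hypotheses (fK : cancel f g) (gK : cancel g f).
Hypothesis fM : {mono f : x y / (x <= y)%O}.

Lemma lower_iso x : poset_iso (elts (lower x)) (elts (lower (f x))).
Proof.
have inI (y : elts (lower x)) : (lo I <= (elt_val y : ppart (itv_dim I)) <= hi I)%O.
  by rewrite (ge_lo y) (le_trans (le_hi y) (le_hi x)).
have inJ (y : elts (lower (f x))) :
    (lo J <= (elt_val y : ppart (itv_dim J)) <= hi J)%O.
  by rewrite (ge_lo y) (le_trans (le_hi y) (le_hi (f x))).
pose i y : elts I := Elt (inI y); pose j y : elts J := Elt (inJ y).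
have outJ y : (lo J <= val (f (i y)) <= val (f x))%O.
  rewrite ge_lo; change (f (i y) <= f x)%O; rewrite fM; exact: (le_hi y).
have outI y : (lo I <= val (g (j y)) <= val x)%O.
  rewrite ge_lo; change (g (j y) <= x)%O; rewrite -fM gK; exact: (le_hi y).
apply/poset_isoP; exists (fun y => @Elt (lower (f x)) _ (outJ y)).
  exists (fun y => @Elt (lower x) _ (outI y)) => y; apply: val_inj => /=.
    by rewrite (_ : j _ = f (i y)) ?fK //; apply: val_inj.
  by rewrite (_ : i _ = g (j y)) ?gK //; apply: val_inj.
by move=> y z; exact: fM (i y) (i z).
Qed.

Lemma upper_iso x : poset_iso (elts (upper x)) (elts (upper (f x))).
Proof.
have inI (y : elts (upper x)) : (lo I <= (elt_val y : ppart (itv_dim I)) <= hi I)%O.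
  by rewrite (le_trans (ge_lo x) (ge_lo y)) (le_hi y).
have inJ (y : elts (upper (f x))) :
    (lo J <= (elt_val y : ppart (itv_dim J)) <= hi J)%O.
  by rewrite (le_trans (ge_lo (f x)) (ge_lo y)) (le_hi y).
pose i y : elts I := Elt (inI y); pose j y : elts J := Elt (inJ y).
have outJ y : (val (f x) <= val (f (i y)) <= hi J)%O.
  rewrite le_hi andbT; change (f x <= f (i y))%O; rewrite fM; exact: (ge_lo y).
have outI y : (val x <= val (g (j y)) <= hi I)%O.
  rewrite le_hi andbT; change (x <= g (j y))%O; rewrite -fM gK; exact: (ge_lo y).
apply/poset_isoP; exists (fun y => @Elt (upper (f x)) _ (outJ y)).
  exists (fun y => @Elt (upper x) _ (outI y)) => y; apply: val_inj => /=.
    by rewrite (_ : j _ = f (i y)) ?fK //; apply: val_inj.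
  by rewrite (_ : i _ = g (j y)) ?gK //; apply: val_inj.
by move=> y z; exact: fM (i y) (i z).
Qed.
End SubintervalIso.

(* The family F of isomorphism classes of intervals. *)
Definition itv_iso (I J : interval) : bool := poset_iso (elts I) (elts J).

Lemma itv_iso_refl : reflexive itv_iso.
Proof. by move=> I; apply: poset_iso_refl. Qed.
Lemma itv_iso_sym : symmetric itv_iso.
Proof. by move=> I J; apply: poset_iso_sym. Qed.
Lemma itv_iso_trans : transitive itv_iso.
Proof. by move=> J I K; apply: poset_iso_trans. Qed.

Canonical itv_iso_equiv := EquivRel itv_iso itv_iso_refl itv_iso_sym itv_iso_trans.

Definition iclass : Type := {eq_quot itv_iso}%qT.
HB.instance Definition _ := Choice.on iclass.

Definition cls (I : interval) : iclass := (\pi_{eq_quot itv_iso} I)%qT.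
Definition rep (c : iclass) : interval := @repr _ {eq_quot itv_iso}%qT c.

Lemma repK c : cls (rep c) = c. Proof. exact: reprK. Qed.

Lemma cls_eqP I J : reflect (cls I = cls J) (poset_iso (elts I) (elts J)).
Proof.
by apply: (iffP idP) => [h|/eqP]; [apply/eqmodP | rewrite eqmodE].
Qed.

Lemma rep_cls I : poset_iso (elts (rep (cls I))) (elts I).
Proof. by apply/cls_eqP; rewrite repK. Qed.

(* [P][Q] = [P x Q] *)
Definition itv_prod (I J : interval) : interval := xchoose (itv_prod_closed I J).

Lemma itv_prodP I J : poset_iso (elts (itv_prod I J)) (elts I *p elts J).
Proof. exact: xchooseP (itv_prod_closed I J). Qed.

Definition mul_cls (c e : iclass) : iclass := cls (itv_prod (rep c) (rep e)).

Lemma mul_clsE I J K : poset_iso (elts K) (elts I *p elts J) ->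
  mul_cls (cls I) (cls J) = cls K.
Proof.
move=> h; apply/cls_eqP; apply: poset_iso_trans (itv_prodP _ _) _.
rewrite poset_iso_sym; apply: poset_iso_trans h _; rewrite poset_iso_sym.
by apply: poset_iso_prod; apply: rep_cls.
Qed.

(* Pi_1 has exactly one element. *)
Definition one_itv : interval := Itv (lexx (pp_bot 1)).
Definition one_cls : iclass := cls one_itv.

Lemma card_one_itv : #|{: elts one_itv}| = 1%N.
Proof.
have h : (pp_bot 1 <= pp_bot 1 <= pp_bot 1)%O by rewrite lexx.
apply/eqP/card1P; exists (@Elt one_itv _ h) => x; apply/esym/eqP.
by apply: val_inj; apply: pt_inj => i; rewrite [LHS]ord1 [RHS]ord1.
Qed.

Lemma one_clsP I : reflect (cls I = one_cls) (#|{: elts I}| == 1%N).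
Proof.
apply: (iffP eqP) => [c1|/cls_eqP/poset_iso_card->]; last exact: card_one_itv.
by apply/cls_eqP; apply: poset_iso_one => //; apply: card_one_itv.
Qed.

Lemma rep_mul c e :
  poset_iso (elts (rep (mul_cls c e))) (elts (rep c) *p elts (rep e)).
Proof. exact: poset_iso_trans (rep_cls _) (itv_prodP _ _). Qed.

Lemma mul_clsC : commutative mul_cls.
Proof.
move=> c e; apply/cls_eqP; apply: poset_iso_trans (itv_prodP _ _) _.
rewrite poset_iso_sym; apply: poset_iso_trans (itv_prodP _ _) _.
exact: poset_iso_prodC.
Qed.

Lemma mul_clsA : associative mul_cls.
Proof.
move=> c d e; apply/cls_eqP; apply: poset_iso_trans (itv_prodP _ _) _.
apply: poset_iso_trans (poset_iso_prod (poset_iso_refl _) (rep_mul _ _)) _.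
apply: poset_iso_trans (poset_iso_prodA _ _ _) _.
rewrite poset_iso_sym; apply: poset_iso_trans (itv_prodP _ _) _.
exact: poset_iso_prod (rep_mul _ _) (poset_iso_refl _).
Qed.

Lemma mul_1cls : left_id one_cls mul_cls.
Proof.
move=> c; rewrite -[RHS]repK; apply/cls_eqP.
apply: poset_iso_trans (itv_prodP _ _) (poset_iso_prod1 _ _).
by rewrite (poset_iso_card (rep_cls _)) card_one_itv.
Qed.

Lemma mul_cls1 : right_id one_cls mul_cls.
Proof. by move=> c; rewrite mul_clsC mul_1cls. Qed.

Lemma mul_cls_eq1 c e : mul_cls c e = one_cls -> c = one_cls /\ e = one_cls.
Proof.
move/one_clsP; rewrite (poset_iso_card (itv_prodP _ _)) card_prod muln_eq1.
by case/andP=> /one_clsP + /one_clsP; rewrite !repK => -> ->.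
Qed.

HB.instance Definition _ := Choice_isMonomialDef.Build iclass
  mul_clsA mul_1cls mul_cls1 mul_cls_eq1.
HB.instance Definition _ := MonomialDef_isConomialDef.Build iclass mul_clsC.

(* Products of monoids of monomials: {malg k[M * N]}, with basis M * N, is    *)
(* the tensor product of the algebras {malg k[M]} and {malg k[N]}.            *)
Section ProdMonomials.
Variables M N : conomType.

Definition one_pair : M * N := (mone, mone).
Definition mul_pair (x y : M * N) : M * N := (mmul x.1 y.1, mmul x.2 y.2).

Fact mul_pairA : associative mul_pair.
Proof. by move=> x y z; rewrite /mul_pair !mulmA. Qed.
Fact mul_1pair : left_id one_pair mul_pair.
Proof. by move=> [x y]; rewrite /mul_pair !mul1m. Qed.
Fact mul_pair1 : right_id one_pair mul_pair.
Proof. by move=> [x y]; rewrite /mul_pair !mulm1. Qed.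
Fact mul_pair_eq1 x y : mul_pair x y = one_pair -> x = one_pair /\ y = one_pair.
Proof. by case: x y => [a b] [c d] [/unitm[-> ->] /unitm[-> ->]]. Qed.
Fact mul_pairC : commutative mul_pair.
Proof. by move=> x y; congr (_, _); rewrite mulmC. Qed.

HB.instance Definition _ := Choice_isMonomialDef.Build (M * N)%type
  mul_pairA mul_1pair mul_pair1 mul_pair_eq1.
HB.instance Definition _ := MonomialDef_isConomialDef.Build (M * N)%type mul_pairC.
End ProdMonomials.

Section LinearExtension.
Variables (k : fieldType) (M : conomType) (V : lmodType k).

(* The linear map sending each basis element m to h m. *)
Definition lin_ext (h : M -> V) (u : {malg k[M]}) : V :=
  \sum_(m <- msupp u) u@_m *: h m.

Lemma lin_extEw (h : M -> V) (u : {malg k[M]}) (D : {fset M}) :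
  (msupp u `<=` D)%fset -> lin_ext h u = \sum_(m <- D) u@_m *: h m.
Proof.
move=> sD; rewrite /lin_ext (big_fset_incl _ sD) // => m _.
by move/mcoeff_outdom->; rewrite scale0r.
Qed.

Lemma lin_ext_is_linear h : linear (lin_ext h).
Proof.
move=> c u v; pose D := (msupp u `|` msupp v)%fset.
have sD : (msupp (c *: u + v) `<=` D)%fset.
  apply: fsubset_trans (msuppD_le _ _) _; apply: fsetUSS => //.
  exact: msuppZ_le.
rewrite (lin_extEw h sD) (lin_extEw h (fsubsetUl _ _ : msupp u `<=` D)%fset).
rewrite (lin_extEw h (fsubsetUr _ _ : msupp v `<=` D)%fset).
rewrite scaler_sumr -big_split /=; apply: eq_bigr => m _.
by rewrite mcoeffD mcoeffZ scalerDl scalerA.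
Qed.

HB.instance Definition _ h := GRing.isLinear.Build k {malg k[M]} V *:%R
  (lin_ext h) (lin_ext_is_linear h).

Lemma lin_extU h m : lin_ext h << m >> = h m.
Proof.
by rewrite (lin_extEw h msuppU_le) big_seq_fset1 mcoeffUU scale1r.
Qed.
End LinearExtension.

Section TensorProduct.
Variable k : fieldType.
Implicit Types M N P : conomType.

Definition tens M N (u : {malg k[M]}) (v : {malg k[N]}) : {malg k[(M * N)%type]} :=
  lin_ext (fun m => lin_ext (fun n => << (m, n) >>) v) u.

Lemma tensU M N (m : M) (n : N) :
  tens << m >> << n >> = << (m, n) >> :> {malg k[(M * N)%type]}.
Proof. by rewrite /tens !lin_extU. Qed.

Definition tens_map M N M' N' (f : {malg k[M]} -> {malg k[M']})
    (g : {malg k[N]} -> {malg k[N']}) : {malg k[(M * N)%type]} -> {malg k[(M' * N')%type]} :=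
  lin_ext (fun mn => tens (f << mn.1 >>) (g << mn.2 >>)).

Definition tens_assoc M N P : {malg k[(M * N * P)%type]} -> {malg k[(M * (N * P))%type]} :=
  lin_ext (fun x => << (x.1.1, (x.1.2, x.2)) >>).

(* The map u (x) v |-> f u * g v. *)
Definition tens_mul M (f g : {malg k[M]} -> {malg k[M]}) :
    {malg k[(M * M)%type]} -> {malg k[M]} :=
  lin_ext (fun mn => f << mn.1 >> * g << mn.2 >>).

Definition algebra_morphism (A B : algType k) (f : A -> B) : Prop :=
  linear f /\ monoid_morphism f.

Lemma malg_lin M (u : {malg k[M]}) : u = \sum_(m <- msupp u) u@_m *: << m >>.
Proof.
rewrite {1}[u]monalgE; apply: eq_bigr => m _; apply/malgP => x.
by rewrite mcoeffZ !mcoeffU mulrnAr mulr1.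
Qed.

Lemma malgUM M (m n : M) : << m >> * << n >> = << mmul m n >> :> {malg k[M]}.
Proof. by rewrite malgM_def fgmulUU mulr1. Qed.

Lemma lin_ext_morphism M (A : algType k) (h : M -> A) : h mone = 1 ->
  (forall m n, h (mmul m n) = h m * h n) -> algebra_morphism (lin_ext h).
Proof.
move=> h1 hM; split; first exact: lin_ext_is_linear.
split; first by rewrite (_ : 1 = << mone >>) // lin_extU.
move=> u v.
have -> : u * v = \sum_(m <- msupp u) \sum_(n <- msupp v)
    (u@_m * v@_n) *: << mmul m n >>.
  rewrite {1}[u]malg_lin {1}[v]malg_lin mulr_suml; apply: eq_bigr => m _.
  rewrite mulr_sumr; apply: eq_bigr => n _.
  by rewrite -scalerAl -scalerAr malgUM scalerA.
rewrite linear_sum [in RHS]/lin_ext mulr_suml; apply: eq_bigr => m _.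
rewrite linear_sum mulr_sumr; apply: eq_bigr => n _.
by rewrite linearZ /= lin_extU hM -scalerAl -scalerAr scalerA.
Qed.

Record is_Hopf_algebra M (Delta : {malg k[M]} -> {malg k[(M * M)%type]})
    (eps : {malg k[M]} -> k) : Prop := IsHopfAlgebra {
  comul_morphism : algebra_morphism Delta;
  counit_morphism : algebra_morphism (eps : {malg k[M]} -> k^o);
  comul_coassoc : forall u,
    tens_assoc (tens_map Delta id (Delta u)) = tens_map id Delta (Delta u);
  comul_counitl : forall u,
    tens_mul (fun v => (eps v)%:MP) id (Delta u) = u;
  comul_counitr : forall u,
    tens_mul id (fun v => (eps v)%:MP) (Delta u) = u;
  has_antipode : exists S : {malg k[M]} -> {malg k[M]},
    [/\ linear S, forall u, tens_mul S id (Delta u) = (eps u)%:MP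
      & forall u, tens_mul id S (Delta u) = (eps u)%:MP]
}.

(* Antipodes being unique, such a map commutes with them. *)
Record is_Hopf_isomorphism M N
    (DeltaM : {malg k[M]} -> {malg k[(M * M)%type]}) (epsM : {malg k[M]} -> k)
    (DeltaN : {malg k[N]} -> {malg k[(N * N)%type]}) (epsN : {malg k[N]} -> k)
    (f : {malg k[M]} -> {malg k[N]}) : Prop := IsHopfIsomorphism {
  iso_morphism : algebra_morphism f;
  iso_bijective : bijective f;
  iso_comul : forall u, DeltaN (f u) = tens_map f f (DeltaM u);
  iso_counit : forall u, epsN (f u) = epsM u
}.
End TensorProduct.

Section IncidenceHopfAlgebra.
Variable k : fieldType.

(* The coproduct of a class, read off a representative P:                     *)
(* sum over x in P of [lo, x] (x) [x, hi].                                    *)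
Definition comul_itv (I : interval) : {malg k[(iclass * iclass)%type]} :=
  \sum_(x : elts I) << (cls (lower x), cls (upper x)) >>.

Definition inc_comul : {malg k[iclass]} -> {malg k[(iclass * iclass)%type]} :=
  lin_ext (fun c => comul_itv (rep c)).

Definition inc_counit : {malg k[iclass]} -> k :=
  lin_ext (V := k^o) (fun c => (c == one_cls)%:R).

Lemma comul_itv_iso I J : poset_iso (elts I) (elts J) -> comul_itv I = comul_itv J.
Proof.
case/poset_isoP => f [g fK gK] fM.
rewrite /comul_itv [RHS](reindex f); last by exists g => x _.
apply: eq_bigr => x _; congr (<< (_, _) >>); apply/cls_eqP.
  exact: lower_iso fK gK fM x.
exact: upper_iso fK gK fM x.
Qed.

Lemma inc_comulE I : inc_comul << cls I >> = comul_itv I.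
Proof. by rewrite /inc_comul lin_extU; apply/comul_itv_iso/rep_cls. Qed.
End IncidenceHopfAlgebra.

Section CompositionHopfAlgebra.
Variable k : fieldType.

Definition gen_index : Type := {n : nat | (1 < n)%N}.
HB.instance Definition _ := Choice.on gen_index.

Local Notation mon := {cmonom gen_index}.

(* The generators a_n for n >= 2, with the convention a_1 = 1. *)
Definition gen (n : nat) : {malg k[mon]} :=
  if @insub _ (fun n => 1 < n)%N gen_index n is Some i then << ucm i >> else 1.

(* The coefficients of the power series sum_(n >= 1) c_n x^n / (n - 1)!. *)
Definition gen_series (V : lmodType k) (c : nat -> V) (n : nat) : V :=
  if n is m.+1 then (m`!%:R)^-1 *: c n else 0.

(* The coefficients of f(g(x)), for g with no constant term: that of x^n only *)
(* depends on the coefficients of f and g of index at most n.                 *)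
Definition series_comp (A : comNzRingType) (f g : nat -> A) (n : nat) : A :=
  ((\poly_(i < n.+1) f i) \Po (\poly_(i < n.+1) g i))`_n.

Lemma series_comp0 (A : comNzRingType) (f g : nat -> A) :
  f 0 = 0 -> series_comp f g 0 = 0.
Proof.
move=> f0; rewrite /series_comp (_ : \poly_(i < 1) f i = 0) ?comp_poly0 ?coef0 //.
by rewrite poly_def big_ord1 f0 scale0r.
Qed.

Lemma series_comp1 (A : comNzRingType) (f g : nat -> A) :
  f 0 = 0 -> g 0 = 0 -> series_comp f g 1 = f 1 * g 1.
Proof.
move=> f0 g0; rewrite /series_comp !poly_def !big_ord_recr !big_ord0 /=.
rewrite f0 g0 !scale0r !add0r !expr1 comp_polyZ comp_polyX.
by rewrite !coefZ coefX mulr1.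
Qed.

Definition F1 : nat -> {malg k[(mon * mon)%type]} := gen_series (fun n => tens (gen n) 1).
Definition F2 : nat -> {malg k[(mon * mon)%type]} := gen_series (fun n => tens 1 (gen n)).

(* The value of Delta(a_n) read off Delta(F)(x) = F2(F1(x)). *)
Definition comul_gen (n : nat) : {malg k[(mon * mon)%type]} :=
  (n.-1)`!%:R *: series_comp F2 F1 n.

Definition comp_comul : {malg k[mon]} -> {malg k[(mon * mon)%type]} :=
  lin_ext (fun m : mon => \prod_(i <- finsupp m) comul_gen (val i) ^+ m i).

(* Evaluation at the identity series x, i.e. at a_n = 0 for n >= 2. *)
Definition comp_counit : {malg k[mon]} -> k :=
  lin_ext (V := k^o) (fun m : mon => (m == mone)%:R).

Lemma comp_comul_morphism : algebra_morphism comp_comul.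
Proof.
have prodE (m : mon) (D : {fset gen_index}) : (finsupp m `<=` D)%fset ->
    \prod_(i <- finsupp m) comul_gen (val i) ^+ m i =
    \prod_(i <- D) comul_gen (val i) ^+ m i.
  move=> sD; rewrite (big_fset_incl _ sD) // => i _.
  by rewrite -cmE_eq0 => /eqP->; rewrite expr0.
apply: lin_ext_morphism => [|m n]; first by rewrite mdom1 big_seq_fset0.
rewrite mdomD (prodE m _ (fsubsetUl _ (finsupp n))).
rewrite (prodE n _ (fsubsetUr (finsupp m) _)) -big_split /=.
by apply: eq_bigr => i _; rewrite cmM exprD.
Qed.

Lemma comp_comul_gen n : (1 < n)%N -> comp_comul (gen n) = comul_gen n.
Proof.
move=> n1; rewrite /gen insubT /comp_comul lin_extU mdomU big_seq_fset1.
by rewrite cmUU expr1.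
Qed.

Lemma F1_1 : F1 1 = 1.
Proof.
rewrite /F1 /gen_series fact0 invr1 scale1r /gen insubF // /tens.
by rewrite (_ : 1 = << mone >>) // !lin_extU.
Qed.

Lemma F2_1 : F2 1 = 1.
Proof.
rewrite /F2 /gen_series fact0 invr1 scale1r /gen insubF // /tens.
by rewrite (_ : 1 = << mone >>) // !lin_extU.
Qed.

(* Delta(F)(x) = F2(F1(x)), which with multiplicativity determines comp_comul. *)
Lemma comp_comul_series : [pchar k] =i pred0 ->
  gen_series (fun n => comp_comul (gen n)) =1 series_comp F2 F1.
Proof.
move=> k0 [|n].
  by rewrite series_comp0.
have [->|n0] := posnP n.
  rewrite /gen_series fact0 invr1 scale1r /gen insubF //.
  have -> : comp_comul 1 = 1 by case: comp_comul_morphism => _ [].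
  by rewrite series_comp1 // F1_1 F2_1 mulr1.
rewrite /gen_series comp_comul_gen // /comul_gen scalerA mulVf ?scale1r //.
by rewrite ((pcharf0P _).1 k0) -lt0n fact_gt0.
Qed.
End CompositionHopfAlgebra.

(* Main.v *)
(* Every interval is a product, over the blocks of its top element, of posets *)
(* Pi_{n,1}.  These posets are irreducible: in a factorization P x Q, each    *)
(* atom lies below (1, 0) or below (0, 1), and the atoms of Pi_{n,1} merging  *)
(* an element with the distinguished one all have to lie on the same side.    *)
(* Hence, for n > 1, the number of x with [x, 1] isomorphic to Pi_{n,1} is    *)
(* additive under products; it vanishes on Pi_{m,1} for m < n and is 1 for    *)
(* m = n, so that the classes of the Pi_{n,1} freely generate the monoid of   *)
(* classes.  The coproduct of Pi_{n,1} is a sum over idempotent maps of [n]   *)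
(* fixing a given point.  Grouping them by their set S of fixed points, the   *)
(* maps from the complement of S to S are counted by an |S|-th power of an    *)
(* exponential generating function, which gives the composition of series.    *)

From HB Require Import structures.
From mathcomp Require Import all_boot all_order all_algebra perm.
From mathcomp Require Import finmap.
From mathcomp.multinomials Require Import monalg.
Require Import Defs.

Set Implicit Arguments.
Unset Strict Implicit.
Unset Printing Implicit Defensive.

Import Order.TTheory GRing.Theory.

Local Open Scope ring_scope.

(** * Decomposition of intervals *)

(** A pointed partition is handled as its idempotent map [pt]. In [a, b] the blocks of b evolve
    independently, and inside each of them the blocks of a move as units, so the class of [a, b] is
    the product over the blocks of b of classes [pic m], that is of Pi_{m+1,1} ([icls_pic]). The
    nontrivial [pic m] are irreducible ([pic_irreducible]); this makes the counts [upper_count k]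
    additive, and since they are triangular on the [pic m], a class determines its exponents
    ([theta_inj]). Hence [expo] is an isomorphism from the monoid of classes to the monomials, and
    its linear extension is an algebra isomorphism sending Pi_{n,1} to a_n.

    Both coproducts being multiplicative, they need only be compared on Pi_{m+1,1}. An element x is
    an idempotent map fixing 0; [0, x] is the product of the generators indexed by the block sizes
    of x, and [x, 1] is the generator indexed by the number of blocks ([tens_map_inc_comul_pic]). If
    x has v+1 points, the v points other than 0 are chosen in C(m, v) ways, and the maps from the
    m-v other elements to the points have total weight (m-v)! times the coefficient of x^(m-v) in
    W(x)^(v+1), where W(x) is the sum of the a_{j+1} x^j/j! ([sum_maps_to]). As F1(x) = x W(x) and
    C(m, v) (m-v)! = m!/v!, the sum is m! times the coefficient of x^(m+1) in F2(F1(x))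
    ([series_comp_exp]).

    The Hopf axioms are proved on the incidence side: coassociativity is an exchange of sums over
    chains, and the antipode is built by recursion on intervals, like a Moebius function. The
    isomorphism carries them to the composition side ([relabel_is_Hopf]). *)

Lemma poset_iso_emb d d' d'' (P : finPOrderType d) (Q : finPOrderType d')
    (X : porderType d'') (i : P -> X) (j : Q -> X) :
  {mono i : x y / (x <= y)%O} -> {mono j : x y / (x <= y)%O} ->
  (forall p, exists q, j q = i p) -> (forall q, exists p, i p = j q) ->
  poset_iso P Q.
Proof.
move=> iM jM ij ji.
have iI : injective i by move=> x y e; apply/le_anti; rewrite -!iM e lexx.
have jI : injective j by move=> x y e; apply/le_anti; rewrite -!jM e lexx.
have ij' p : exists q, j q == i p by have [q <-] := ij p; exists q.
have ji' q : exists p, i p == j q by have [p <-] := ji q; exists p.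
pose f p := xchoose (ij' p); pose g q := xchoose (ji' q).
have fE p : j (f p) = i p by apply/eqP/(xchooseP (ij' p)).
have gE q : i (g q) = j q by apply/eqP/(xchooseP (ji' q)).
apply/poset_isoP; exists f => [|x y]; last by rewrite -jM !fE iM.
by exists g => x; [apply: iI; rewrite gE fE | apply: jI; rewrite fE gE].
Qed.

(* The class of [a, b]; a junk value unless a <= b. *)
Definition icls n (a b : ppart n.+1) : iclass :=
  if @insub _ (fun ab : ppart n.+1 * ppart n.+1 => (ab.1 <= ab.2)%O)
      {ab : ppart n.+1 * ppart n.+1 | (ab.1 <= ab.2)%O} (a, b) is Some ab
  then cls (existT _ n ab) else one_cls.

Lemma iclsE n (a b : ppart n.+1) (ab : (a <= b)%O) : icls a b = cls (Itv ab).
Proof. by rewrite /icls insubT. Qed.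

Lemma cls_icls I : cls I = icls (lo I) (hi I).
Proof. by case: I => n [[a b] ab]; rewrite (@iclsE n a b ab). Qed.

Section IntervalIso.
Variables (n m : nat) (a b : ppart n.+1) (c d : ppart m.+1).
Variables (F : ppart n.+1 -> ppart m.+1) (G : ppart m.+1 -> ppart n.+1).
Hypotheses (ab : (a <= b)%O) (Fa : F a = c) (Fb : F b = d) (Gc : G c = a) (Gd : G d = b).
Hypothesis FM : forall x y, (a <= x)%O -> (x <= y)%O -> (y <= b)%O -> (F x <= F y)%O.
Hypothesis GM : forall x y, (c <= x)%O -> (x <= y)%O -> (y <= d)%O -> (G x <= G y)%O.
Hypothesis FK : forall x, (a <= x)%O -> (x <= b)%O -> G (F x) = x.
Hypothesis GK : forall x, (c <= x)%O -> (x <= d)%O -> F (G x) = x.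

(** [F] and [G] are maps between the whole posets, controlled only on the two intervals, so that
    applications need not build elements of interval types. *)
Lemma icls_iso : icls a b = icls c d.
Proof.
have cd : (c <= d)%O by rewrite -Fa -Fb FM.
rewrite (iclsE ab) (iclsE cd); apply/cls_eqP.
have Fin (x : elts (Itv ab)) : (c <= F (val x) <= d)%O.
  by rewrite -Fa -Fb !FM ?(ge_lo x) ?(le_hi x).
apply: (@poset_iso_emb _ _ _ (elts (Itv ab)) (elts (Itv cd)) (ppart m.+1)
  (fun x => F (val x)) (fun y => val y)) => //.
- move=> x y; apply/idP/idP => [/GM|]; last first.
    by move/FM; apply; [exact: (ge_lo x)|exact: (le_hi y)].
  rewrite !FK ?(ge_lo x) ?(ge_lo y) ?(le_hi x) ?(le_hi y) //.
  by apply; [case/andP: (Fin x)|case/andP: (Fin y)].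
- by move=> x; exists (@Elt (Itv cd) _ (Fin x)).
- move=> y; have yin : (a <= G (val y) <= b)%O.
    by rewrite -Gc -Gd !GM ?(ge_lo y) ?(le_hi y).
  exists (@Elt (Itv ab) _ yin); apply: GK; [exact: (ge_lo y)|exact: (le_hi y)].
Qed.
End IntervalIso.

Section IntervalProd.
Variables (n m m' : nat) (a b : ppart n.+1) (c d : ppart m.+1) (c' d' : ppart m'.+1).
Variables (F : ppart n.+1 -> ppart m.+1) (F' : ppart n.+1 -> ppart m'.+1).
Variable G : ppart m.+1 -> ppart m'.+1 -> ppart n.+1.
Hypotheses (ab : (a <= b)%O) (Fa : F a = c) (Fb : F b = d) (Fa' : F' a = c') (Fb' : F' b = d').
Hypotheses (Gc : G c c' = a) (Gd : G d d' = b).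
Hypothesis FM : forall x y, (a <= x)%O -> (x <= y)%O -> (y <= b)%O ->
  (F x <= F y)%O /\ (F' x <= F' y)%O.
Hypothesis GM : forall x y x' y', (c <= x)%O -> (x <= y)%O -> (y <= d)%O ->
  (c' <= x')%O -> (x' <= y')%O -> (y' <= d')%O -> (G x x' <= G y y')%O.
Hypothesis FK : forall x, (a <= x)%O -> (x <= b)%O -> G (F x) (F' x) = x.
Hypothesis GK : forall x x', (c <= x)%O -> (x <= d)%O -> (c' <= x')%O -> (x' <= d')%O ->
  F (G x x') = x /\ F' (G x x') = x'.

Lemma icls_prod : icls a b = mmul (icls c d) (icls c' d').
Proof.
have [cd cd'] : (c <= d)%O /\ (c' <= d')%O by rewrite -Fa -Fb -Fa' -Fb'; apply: FM.
rewrite (iclsE ab) (iclsE cd) (iclsE cd'); apply/esym/mul_clsE.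
have Fin (x : elts (Itv ab)) : (c <= F (val x) <= d)%O.
  by rewrite -Fa -Fb !(FM _ _ _).1 ?(ge_lo x) ?(le_hi x).
have Fin' (x : elts (Itv ab)) : (c' <= F' (val x) <= d')%O.
  by rewrite -Fa' -Fb' !(FM _ _ _).2 ?(ge_lo x) ?(le_hi x).
apply: (@poset_iso_emb _ _ _ (elts (Itv ab)) (elts (Itv cd) *p elts (Itv cd'))
  (ppart m.+1 *p ppart m'.+1)
  (fun x => (F (val x), F' (val x))) (fun y => (val y.1, val y.2))).
- move=> x y.
  change ((F (val x) <= F (val y))%O && (F' (val x) <= F' (val y))%O = (val x <= val y)%O).
  have [/andP[? ?] /andP[? ?]] := (Fin x, Fin' x).
  have [/andP[? ?] /andP[? ?]] := (Fin y, Fin' y).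
  apply/andP/idP => [[h h']|h]; last first.
    by apply: FM => //; [exact: (ge_lo x)|exact: (le_hi y)].
  rewrite -(FK (ge_lo x) (le_hi x)) -(FK (ge_lo y) (le_hi y)); exact: GM.
- by move=> [x x'] [y y'].
- by move=> x; exists (@Elt (Itv cd) _ (Fin x), @Elt (Itv cd') _ (Fin' x)).
- move=> [y y'].
  have yin : (a <= G (val y) (val y') <= b)%O.
    by rewrite -Gc -Gd !GM ?(ge_lo y) ?(le_hi y) ?(ge_lo y') ?(le_hi y').
  exists (@Elt (Itv ab) _ yin) => /=.
  by have [-> ->] := GK (ge_lo y) (le_hi y) (ge_lo y') (le_hi y').
Qed.
End IntervalProd.

(* The pointed partition pp_bot is a junk value, for maps that are not idempotent. *)
Definition pp_fun n (f : 'I_n -> 'I_n) : ppart n :=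
  match [forall i, f (f i) == f i] =P true with
  | ReflectT e => pp_of_idem (fun i => eqP (forallP e i))
  | ReflectF _ => pp_bot n
  end.

Lemma pt_pp_fun n (f : 'I_n -> 'I_n) : (forall i, f (f i) = f i) -> pt (pp_fun f) =1 f.
Proof.
move=> fK; rewrite /pp_fun; case: eqP => [e i|[]]; first by rewrite pt_of_idem.
by apply/forallP => i; rewrite fK.
Qed.

Lemma ppart_leP n (x y : ppart n) :
  reflect (forall i, pt y (pt x i) = pt y i /\ pt x (pt y i) = pt y i) (x <= y)%O.
Proof. exact: pp_leP. Qed.

Lemma pt_bot n i : pt (pp_bot n) i = i.
Proof. by rewrite pt_of_idem. Qed.

Lemma le_bot n (x : ppart n) : (pp_bot n <= x)%O.
Proof. by apply/ppart_leP => i; rewrite !pt_bot. Qed.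

Lemma pp_fun_eq n (f : 'I_n -> 'I_n) (x : ppart n) : f =1 pt x -> pp_fun f = x.
Proof. by move=> fx; apply: pt_inj => i; rewrite pt_pp_fun // => j; rewrite !fx ptK. Qed.

(** * Splitting an interval along a union of blocks *)

Section Splitting.
Variables (n : nat) (D : pred 'I_n).
Implicit Types x y : ppart n.

(** Meaningful when [D] is a union of blocks of [x] and of [y], which is what [saturated] expresses;
    otherwise the map may fail to be idempotent and [pp_fun] returns its default. *)
Definition glue x y : ppart n := pp_fun (fun i => if D i then pt x i else pt y i).

Definition saturated x := forall i, D (pt x i) = D i.

Lemma pt_glue x y i : saturated x -> saturated y ->
  pt (glue x y) i = if D i then pt x i else pt y i.
Proof.
by move=> sx sy; rewrite pt_pp_fun // => j; case Dj: (D j);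
  rewrite ?(sx, sy) Dj ptK.
Qed.

Lemma glue_saturated x y : saturated x -> saturated y -> saturated (glue x y).
Proof. by move=> sx sy i; rewrite pt_glue //; case Di: (D i); rewrite ?(sx, sy) Di. Qed.

Lemma saturated_le x y : (x <= y)%O -> saturated y -> saturated x.
Proof. by move=> /ppart_leP xy sy i; rewrite -sy (xy i).1 sy. Qed.

Lemma le_glue x y x' y' : saturated x -> saturated y -> saturated x' -> saturated y' ->
  (x <= x')%O -> (y <= y')%O -> (glue x y <= glue x' y')%O.
Proof.
move=> sx sy sx' sy' /ppart_leP xx' /ppart_leP yy'; apply/ppart_leP => i; rewrite !pt_glue //.
by case Di: (D i); rewrite ?(sx, sy, sx', sy') Di; [apply: xx'|apply: yy'].
Qed.

Lemma glue_id x : glue x x = x.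
Proof. by apply: pp_fun_eq => i; rewrite if_same. Qed.

Lemma pt_between a b x i : (a <= x)%O -> (x <= b)%O -> pt b i = pt a i -> pt x i = pt a i.
Proof.
by move=> /ppart_leP ax /ppart_leP xb e; rewrite -(ax i).1 -e (xb i).2.
Qed.

End Splitting.

(** In each factor one side of [D] varies from [a] to [b] while the other stays as in [a].
    Everything below [b] inherits saturation, so an element of [a, b] is glued from its two
    halves. *)
Lemma icls_split n (D : pred 'I_n.+1) (a b : ppart n.+1) : (a <= b)%O -> saturated D b ->
  icls a b = mmul (icls a (glue D b a)) (icls a (glue D a b)).
Proof.
move=> ab sb; have sa := saturated_le ab sb.
have sB x : (x <= b)%O -> saturated D x by move/saturated_le; apply.
have sl x : (x <= glue D b a)%O -> saturated D x.
  by move/saturated_le; apply; apply: glue_saturated.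
have sr x : (x <= glue D a b)%O -> saturated D x.
  by move/saturated_le; apply; apply: glue_saturated.
have xl x i : (a <= x)%O -> (x <= glue D b a)%O -> D i = false -> pt x i = pt a i.
  by move=> ax xb Di; apply: pt_between ax xb _; rewrite pt_glue // Di.
have xr x i : (a <= x)%O -> (x <= glue D a b)%O -> D i -> pt x i = pt a i.
  by move=> ax xb Di; apply: pt_between ax xb _; rewrite pt_glue // Di.
apply: (@icls_prod _ _ _ _ _ _ _ _ _ (fun x => glue D x a) (fun x => glue D a x)
  (fun x y => glue D x y)); rewrite ?glue_id //.
- apply: pt_inj => i; rewrite !pt_glue //; try exact: glue_saturated.
  by case: ifP => // ->.
- move=> x y ax xy yb; have [sx sy] := (sB _ (le_trans xy yb), sB _ yb).
  by split; apply: le_glue.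
- move=> x y x' y' cx xy yd cx' xy' yd'; apply: le_glue => //.
  + exact: sl (le_trans xy yd).
  + exact: sr (le_trans xy' yd').
  + exact: sl.
  + exact: sr.
- move=> x ax xb; have sx := sB _ xb; apply: pt_inj => i.
  by rewrite !pt_glue //; try exact: glue_saturated; case: (D i).
- move=> x x' cx xd cx' xd'; have [sx sx'] := (sl _ xd, sr _ xd').
  by split; apply: pt_inj => i; rewrite !pt_glue //; try exact: glue_saturated;
    case Di: (D i) => //; rewrite ?(xl x i) ?(xr x' i).
Qed.

(* The blocks of b with pointed element in S, and the blocks of a elsewhere. *)
Definition restr n (a b : ppart n) (S : {set 'I_n}) := glue [pred i | pt b i \in S] b a.

Section Restr.
Variables (n : nat) (a b : ppart n).
Hypothesis ab : (a <= b)%O.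

Implicit Type S : {set 'I_n}.

Lemma fiber_saturated S : saturated [pred i | pt b i \in S] b.
Proof. by move=> i /=; rewrite ptK. Qed.

Lemma pt_restr S i : pt (restr a b S) i = if pt b i \in S then pt b i else pt a i.
Proof.
rewrite pt_glue //; first exact: fiber_saturated.
by apply: saturated_le ab _; apply: fiber_saturated.
Qed.

Lemma pt_b_restr S i : pt b (pt (restr a b S) i) = pt b i.
Proof. by rewrite pt_restr; case: ifP; rewrite ?ptK // ((ppart_leP _ _ ab) i).1. Qed.

Lemma le_restr S : (a <= restr a b S)%O.
Proof.
have ab' := ppart_leP _ _ ab; apply/ppart_leP => i; rewrite !pt_restr (ab' i).1.
by case: ifP; rewrite ?ptK ?(ab' i).2.
Qed.

Lemma restr0 : restr a b set0 = a.
Proof. by apply: pt_inj => i; rewrite pt_restr inE. Qed.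

Lemma restr_points : restr a b (points b) = b.
Proof. by apply: pt_inj => i; rewrite pt_restr pt_point. Qed.

End Restr.

Lemma icls_refl n (a : ppart n.+1) : icls a a = one_cls.
Proof.
rewrite (iclsE (lexx a)); apply/one_clsP; apply/card1P.
have aa : (a <= a <= a)%O by rewrite lexx.
exists (@Elt (Itv (lexx a)) _ aa) => x; apply/esym/eqP/val_inj/le_anti.
by rewrite (ge_lo x) (le_hi x).
Qed.

(** Induction on the size of [S]: [icls_split] along the block of one [p] in [S] detaches the factor
    of [p]. *)
Lemma icls_restr n (a b : ppart n.+1) (S : {set 'I_n.+1}) : (a <= b)%O ->
  icls a (restr a b S) = \big[mmul/mone]_(p in S) icls a (restr a b [set p]).
Proof.
move=> ab; have [N] := ubnP #|S|; elim: N S => // N IH S.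
have [->|[p pS]] := set_0Vmem S; first by rewrite big_set0 restr0 ?icls_refl.
rewrite (big_setD1 p) //= (cardsD1 p S) pS ltnS => cS; rewrite -IH //.
have Sp := le_restr ab S.
have sp : saturated [pred i | pt b i == p] (restr a b S).
  by move=> i /=; rewrite pt_b_restr.
have sa := saturated_le (le_restr ab S) sp.
have -> : restr a b [set p] = glue [pred i | pt b i == p] (restr a b S) a.
  apply: pt_inj => i; rewrite pt_glue // !pt_restr //= inE.
  by case: eqP => // ->; rewrite pS.
have -> : restr a b (S :\ p) = glue [pred i | pt b i == p] a (restr a b S).
  by apply: pt_inj => i; rewrite pt_glue // !pt_restr //= !inE; case: eqP.
exact: icls_split.
Qed.

Lemma icls_blocks n (a b : ppart n.+1) : (a <= b)%O ->
  icls a b = \big[mmul/mone]_(p in points b) icls a (restr a b [set p]).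
Proof. by move=> ab; rewrite -icls_restr // restr_points. Qed.

(** * One block: contraction to the poset Pi_{m+1,1} *)

Definition pp_top m : ppart m.+1 := pp_fun (fun=> ord0).

Lemma pt_top m i : pt (pp_top m) i = ord0.
Proof. by rewrite pt_pp_fun. Qed.

(* The class of Pi_{m + 1, 1}. *)
Definition pic m : iclass := icls (pp_bot m.+1) (pp_top m).

(** The standard enumeration of [B] is corrected by a transposition, so that [p] gets number 0, the
    point of [pp_top]. *)
Lemma enum_fiber (T : finType) (B : {set T}) (p : T) k : p \in B -> #|B| = k.+1 ->
  exists (e : 'I_k.+1 -> T) (r : T -> 'I_k.+1),
    [/\ e ord0 = p, forall j, e j \in B, cancel e r & {in B, cancel r e}].
Proof.
move=> pB cB; pose j0 := cast_ord cB (enum_rank_in pB p).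
pose s := tperm ord0 j0.
exists (fun j => enum_val (cast_ord (esym cB) (s j))).
exists (fun q => s (cast_ord cB (enum_rank_in pB q))); split.
- by rewrite /s tpermL /j0 cast_ordK enum_rankK_in.
- by move=> j; apply: enum_valP.
- by move=> j; rewrite enum_valK_in cast_ordKV tpermK.
- by move=> q qB; rewrite tpermK cast_ordK enum_rankK_in.
Qed.

Section Block.
Variables (n k : nat) (a b : ppart n.+1) (p : 'I_n.+1).
Variables (e : 'I_k.+1 -> 'I_n.+1) (r : 'I_n.+1 -> 'I_k.+1).
Hypotheses (ab : (a <= b)%O) (e0 : e ord0 = p) (er : cancel e r).
Hypotheses (ea : forall j, pt a (e j) = e j) (eb : forall j, pt b (e j) = p).
Hypothesis re : forall q, pt a q = q -> pt b q = p -> e (r q) = q.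

Let bp := restr a b [set p].

Lemma block_bp i : pt bp i = if pt b i == p then p else pt a i.
Proof. by rewrite pt_restr // inE; case: eqP. Qed.

Lemma block_ab i : pt b (pt a i) = pt b i.
Proof. by case: (ppart_leP _ _ ab i). Qed.

Lemma block_er x j : (a <= x)%O -> (x <= bp)%O -> e (r (pt x (e j))) = pt x (e j).
Proof.
move=> /ppart_leP ax xb; apply: re; first by case: (ax (e j)).
by rewrite -(pt_b_restr ab [set p]) (ppart_leP _ _ xb _).1 pt_b_restr // eb.
Qed.

Definition block_F x : ppart k.+1 := pp_fun (fun j => r (pt x (e j))).
Definition block_G (y : ppart k.+1) : ppart n.+1 :=
  pp_fun (fun i => if pt b i == p then e (pt y (r (pt a i))) else pt a i).

Lemma pt_block_F x j : (a <= x)%O -> (x <= bp)%O -> e (pt (block_F x) j) = pt x (e j).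
Proof.
move=> ax xb; rewrite pt_pp_fun ?block_er // => i.
by rewrite block_er ?ptK.
Qed.

Lemma pt_block_G y i :
  pt (block_G y) i = if pt b i == p then e (pt y (r (pt a i))) else pt a i.
Proof.
rewrite pt_pp_fun // => {}i; have [bi|bi] := ifP (pt b i == p).
  by rewrite eb eqxx ea er ptK.
by rewrite block_ab bi ptK.
Qed.

Lemma block_out x i : (a <= x)%O -> (x <= bp)%O -> (pt b i == p) = false ->
  pt x i = pt a i.
Proof. by move=> ax xb bi; apply: pt_between ax xb _; rewrite block_bp bi. Qed.

(** An element of [a, bp] is determined by its [pt] on the points of [a] in the block of [p], since
    each block of [a] follows its point. Renumbering these points by [e] and [r] turns [a] into
    [pp_bot] and [bp] into [pp_top]. *)
Lemma icls_block : icls a bp = pic k.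
Proof.
have eI := can_inj er.
apply: (@icls_iso _ _ _ _ _ _ block_F block_G).
- exact: le_restr.
- by apply: pp_fun_eq => j; rewrite ea er pt_bot.
- by apply: pp_fun_eq => j; rewrite block_bp eb eqxx pt_top -e0 er.
- apply: pt_inj => i; rewrite pt_block_G pt_bot; case: eqP => // bi.
  by rewrite re ?ptK ?block_ab.
- by apply: pt_inj => i; rewrite pt_block_G pt_top block_bp e0.
- move=> x y ax xy yb; have [xb ay] := (le_trans xy yb, le_trans ax xy).
  apply/ppart_leP => j; have := ppart_leP _ _ xy (e j).
  by rewrite -!pt_block_F // => -[/eI -> /eI ->].
- move=> x y _ /ppart_leP xy _; apply/ppart_leP => i; rewrite !pt_block_G.
  case bi: (pt b i == p).
    by rewrite !eb !eqxx !ea !er (xy _).1 (xy _).2.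
  by rewrite block_ab bi ptK.
- move=> x ax xb; apply: pt_inj => i; rewrite pt_block_G.
  case bi: (pt b i == p); last by rewrite (block_out ax xb bi).
  rewrite pt_block_F // re ?ptK ?block_ab ?(eqP bi) //.
  by case: (ppart_leP _ _ ax i).
- move=> y _ _; apply: pp_fun_eq => j.
  by rewrite pt_block_G eb eqxx ea !er.
Qed.
End Block.

Lemma icls_pic n (a b : ppart n.+1) : (a <= b)%O ->
  icls a b = \big[mmul/mone]_(p in points b)
               pic #|[set q in points a | pt b q == p]|.-1.
Proof.
move=> ab; rewrite (icls_blocks ab); apply: eq_bigr => p pb.
have ab' := ppart_leP _ _ ab; have bp : pt b p = p by apply/eqP; rewrite -point_pt.
pose B := [set q in points a | pt b q == p].
have pB : p \in B by rewrite inE bp eqxx point_pt andbT -{1}bp (ab' p).2 bp.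
have [k cB] : exists k, #|B| = k.+1 by exists #|B|.-1; rewrite prednK // (cardD1 p) pB.
have [e [r [e0 eB er re]]] := enum_fiber pB cB.
rewrite -/B cB /=; apply: (icls_block ab e0 er).
- by move=> j; have := eB j; rewrite inE point_pt => /andP[/eqP].
- by move=> j; have := eB j; rewrite inE point_pt => /andP[_ /eqP].
- by move=> q aq bq; apply: re; rewrite inE point_pt aq bq !eqxx.
Qed.

(** * Ideals and filters of products, and sums over the elements of a class *)

Section Ideals.
Variable I : interval.
Implicit Types x y : elts I.

Fact of_lower_subproof x (u : elts (lower x)) :
  (lo I <= (elt_val u : ppart (itv_dim I)) <= hi I)%O.
Proof. by rewrite (ge_lo u) (le_trans (le_hi u) (le_hi x)). Qed.
Definition of_lower x u : elts I := Elt (@of_lower_subproof x u).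

Fact of_upper_subproof x (u : elts (upper x)) :
  (lo I <= (elt_val u : ppart (itv_dim I)) <= hi I)%O.
Proof. by rewrite (le_trans (ge_lo x) (ge_lo u)) (le_hi u). Qed.
Definition of_upper x u : elts I := Elt (@of_upper_subproof x u).

Lemma of_lower_le x u : (@of_lower x u <= x)%O.
Proof. exact: (le_hi u). Qed.

Lemma of_lowerP x y : (y <= x)%O -> exists u, @of_lower x u = y.
Proof.
move=> yx; have yin : (lo I <= val y <= val x)%O by rewrite (ge_lo y).
by exists (@Elt (lower x) _ yin); apply: val_inj.
Qed.

Lemma of_upper_ge x u : (x <= @of_upper x u)%O.
Proof. exact: (ge_lo u). Qed.

Lemma of_upperP x y : (x <= y)%O -> exists u, @of_upper x u = y.
Proof.
move=> xy; have yin : (val x <= val y <= hi I)%O by rewrite (le_hi y) andbT.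
by exists (@Elt (upper x) _ yin); apply: val_inj.
Qed.

Definition elt_lo : elts I := @Elt I (lo I) (introT andP (conj (lexx _) (lo_le_hi I))).
Definition elt_hi : elts I := @Elt I (hi I) (introT andP (conj (lo_le_hi I) (lexx _))).

Lemma elt_lo_le x : (elt_lo <= x)%O. Proof. exact: (ge_lo x). Qed.
Lemma le_elt_hi x : (x <= elt_hi)%O. Proof. exact: (le_hi x). Qed.
End Ideals.

Section ProductIdeals.
Variables (I J K : interval) (f : elts I *p elts J -> elts K).
Hypotheses (fB : bijective f) (fM : {mono f : x y / (x <= y)%O}).

Lemma le_prodE (x x' : elts I) (y y' : elts J) :
  ((x, y) <= (x', y') :> (elts I *p elts J))%O = (x <= x')%O && (y <= y')%O.
Proof. by []. Qed.

Lemma cls_lower_prod x y :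
  cls (lower (f (x, y))) = mmul (cls (lower x)) (cls (lower y)).
Proof.
case: fB => g fK gK; apply/esym/mul_clsE.
pose i := @of_lower K (f (x, y)).
pose j (u : elts (lower x) *p elts (lower y)) : elts K := f (of_lower u.1, of_lower u.2).
have iM : {mono i : x y / (x <= y)%O} by [].
have jM : {mono j : x y / (x <= y)%O} by move=> [u v] [u' v']; rewrite /j fM.
apply: (poset_iso_emb iM jM); rewrite /i /j.
- move=> w; have : (of_lower w <= f (x, y))%O := of_lower_le w.
  rewrite -{1}[of_lower w]gK fM; case e: (g _) => [s t].
  rewrite le_prodE => /andP[/of_lowerP[u eu] /of_lowerP[v ev]].
  by exists (u, v); rewrite eu ev -e gK.
- move=> [u v] /=.
  have /of_lowerP[w <-] : (f (of_lower u, of_lower v) <= f (x, y))%O.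
    by rewrite fM le_prodE !of_lower_le.
  by exists w.
Qed.

Lemma cls_upper_prod x y :
  cls (upper (f (x, y))) = mmul (cls (upper x)) (cls (upper y)).
Proof.
case: fB => g fK gK; apply/esym/mul_clsE.
pose i := @of_upper K (f (x, y)).
pose j (u : elts (upper x) *p elts (upper y)) : elts K := f (of_upper u.1, of_upper u.2).
have iM : {mono i : x y / (x <= y)%O} by [].
have jM : {mono j : x y / (x <= y)%O} by move=> [u v] [u' v']; rewrite /j fM.
apply: (poset_iso_emb iM jM); rewrite /i /j.
- move=> w; have : (f (x, y) <= of_upper w)%O := of_upper_ge w.
  rewrite -{1}[of_upper w]gK fM; case e: (g _) => [s t].
  rewrite le_prodE => /andP[/of_upperP[u eu] /of_upperP[v ev]].
  by exists (u, v); rewrite eu ev -e gK.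
- move=> [u v] /=.
  have /of_upperP[w <-] : (f (x, y) <= f (of_upper u, of_upper v))%O.
    by rewrite fM le_prodE !of_upper_ge.
  by exists w.
Qed.
End ProductIdeals.

Section ClassSum.
Variables (R : Type) (idx : R) (op : Monoid.com_law idx).
Variable G : iclass -> iclass -> R.

(** Generic in the operation: it serves with [addn] for counting, and with [+%R] for the coproduct
    and the antipode. *)
Definition csum (c : iclass) : R :=
  \big[op/idx]_(x : elts (rep c)) G (cls (lower x)) (cls (upper x)).

Lemma csum_cls I :
  csum (cls I) = \big[op/idx]_(x : elts I) G (cls (lower x)) (cls (upper x)).
Proof.
have /poset_isoP[f [g fK gK] fM] := rep_cls I.
rewrite /csum [RHS](reindex f); last by exists g => x _.
apply: eq_bigr => x _; congr G; apply/cls_eqP.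
  exact: lower_iso fK gK fM x.
exact: upper_iso fK gK fM x.
Qed.

Lemma csum_icls n (a b : ppart n.+1) : (a <= b)%O ->
  csum (icls a b) = \big[op/idx]_(x | (a <= x <= b)%O) G (icls a x) (icls x b).
Proof.
move=> ab; rewrite (iclsE ab) csum_cls.
pose h (x : ppart n.+1) : elts (Itv ab) := insubd (elt_lo (Itv ab)) x.
rewrite [RHS](reindex (fun x : elts (Itv ab) => val x)) /=; last first.
  exists h => x; first by rewrite /h valKd.
  by move=> xin; rewrite /h insubdK.
apply: eq_big => [x|x _]; first by rewrite (ge_lo x) (le_hi x).
by rewrite !cls_icls.
Qed.

Lemma csum_mul c d : csum (mmul c d) =
  \big[op/idx]_(x : elts (rep c)) \big[op/idx]_(y : elts (rep d))
    G (mmul (cls (lower x)) (cls (lower y))) (mmul (cls (upper x)) (cls (upper y))).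
Proof.
have /poset_isoP[f fB fM] : poset_iso (elts (rep c) *p elts (rep d)) (elts (rep (mmul c d))).
  by rewrite poset_iso_sym; apply: rep_mul.
rewrite /csum (reindex f) /=; last by case: fB => g fK gK; exists g => x _.
rewrite pair_big_dep /=; apply: eq_bigr => -[x y] _ /=.
by rewrite cls_lower_prod // cls_upper_prod.
Qed.
End ClassSum.

Lemma icls_eq1 n (a b : ppart n.+1) : (a <= b)%O -> (icls a b == one_cls) = (a == b).
Proof.
move=> ab; apply/eqP/eqP => [|->]; last exact: icls_refl.
rewrite (iclsE ab) => /one_clsP/card1P[t tE].
have e x y : x = y :> elts (Itv ab).
  by have := tE x; have := tE y; rewrite !inE => /esym/eqP-> /esym/eqP->.
by have /(congr1 val) := e (elt_lo _) (elt_hi _).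
Qed.

Lemma icls_rep c : icls (lo (rep c)) (hi (rep c)) = c.
Proof. by rewrite -cls_icls repK. Qed.

Lemma icls_ind (P : iclass -> Prop) :
  (forall n (a b : ppart n.+1), (a <= b)%O -> P (icls a b)) -> forall c, P c.
Proof. by move=> h c; rewrite -(icls_rep c); apply: h; apply: lo_le_hi. Qed.

(** * Unique factorization of classes *)

Section Merge.
Variables (n : nat) (i j : 'I_n).
Hypothesis ij : i != j.

(* The atom whose only nontrivial block is {i, j}, pointed at j. *)
Definition merge : ppart n := pp_fun (fun t => if t == i then j else t).

Lemma pt_merge t : pt merge t = if t == i then j else t.
Proof.
rewrite pt_pp_fun // => {}t; case e: (t == i); last by rewrite e.
by rewrite eq_sym (negbTE ij).
Qed.

Lemma merge_leP (w : ppart n) :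
  reflect (pt w i = pt w j /\ pt w i != i) (merge <= w)%O.
Proof.
apply: (iffP (ppart_leP _ _)) => [h|[wij wi] t].
  have := (h i).1; rewrite pt_merge eqxx => <-; split=> //.
  by have := (h j).2; rewrite pt_merge; case: eqP => // -> e; move: ij; rewrite e eqxx.
rewrite !pt_merge; split; first by case: eqP => // ->.
by case: eqP => // wt; rewrite -wt ptK wt eqxx in wi.
Qed.

Lemma merge_min (t : ppart n) : (t <= merge)%O -> t = merge \/ t = pp_bot n.
Proof.
move=> /ppart_leP h.
have tx x : x != i -> pt t x = x.
  by move=> xi; have := (h x).2; rewrite pt_merge (negbTE xi).
have := (h i).1; rewrite !pt_merge eqxx.
have [ti _|_ ti] := eqVneq (pt t i) i; [right|left]; apply: pt_inj => x.
  by rewrite pt_bot; have [->|/tx] := eqVneq x i.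
by rewrite pt_merge; have [->|/tx] := eqVneq x i.
Qed.

Lemma merge_neq_bot : merge != pp_bot n.
Proof.
apply/eqP => e; have := pt_merge i; rewrite e pt_bot eqxx => e'.
by move: ij; rewrite -e' eqxx.
Qed.
End Merge.

Lemma le_top_pt m (w : ppart m.+1) : (w <= pp_top m)%O = (pt w ord0 == ord0).
Proof.
apply/ppart_leP/eqP => [h|w0 i]; last by rewrite !pt_top.
by have := (h ord0).2; rewrite pt_top.
Qed.

Lemma merge_top m (i j : 'I_m.+1) : i != ord0 -> i != j -> (merge i j <= pp_top m)%O.
Proof. by move=> i0 ij; rewrite le_top_pt pt_merge // [ord0 == i]eq_sym (negbTE i0). Qed.

Lemma top_of_merge m (w : ppart m.+1) : (w <= pp_top m)%O ->
  (forall i, i != ord0 -> (merge i ord0 <= w)%O) -> w = pp_top m.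
Proof.
rewrite le_top_pt => /eqP w0 h; apply: pt_inj => i; rewrite pt_top.
by have [->//|i0] := eqVneq i ord0; have /(merge_leP i0)[-> _] := h i i0.
Qed.

Lemma lo_hi_one I : elt_lo I = elt_hi I -> cls I = one_cls.
Proof.
move=> /(congr1 val) e; rewrite cls_icls; have {}e : lo I = hi I by exact e.
by rewrite e icls_refl.
Qed.

(** Let [u] and [v] be the images of (1, 0) and (0, 1). Only the bottom is below both, and every
    atom is below one of them. The atoms [merge i ord0] all lie on the same side, and their only
    upper bound is the top; so [u] or [v] is the top, and the other factor is trivial. *)
Lemma pic_irreducible k c d : mmul c d = pic k -> c = one_cls \/ d = one_cls.
Proof.
move=> cdk; have {}cdk : mul_cls c d = pic k := cdk; pose K := Itv (le_bot (pp_top k)).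
set I := rep c; set J := rep d.
have [f [g fK gK] fM] : exists2 f : elts I *p elts J -> elts K,
    bijective f & {mono f : x y / (x <= y)%O}.
  apply/poset_isoP; rewrite poset_iso_sym; apply: poset_iso_trans (rep_mul c d).
  by rewrite poset_iso_sym cdk /pic (iclsE (le_bot _)); apply: rep_cls.
rewrite -(repK c) -(repK d) -/I -/J.
pose u := f (elt_hi I, elt_lo J); pose v := f (elt_lo I, elt_hi J).
have f0 : val (f (elt_lo I, elt_lo J)) = pp_bot k.+1.
  apply/le_anti; rewrite le_bot andbT.
  have <- : val (elt_lo K) = pp_bot k.+1 by [].
  change (f (elt_lo I, elt_lo J) <= elt_lo K)%O.
  by rewrite -[elt_lo K]gK fM; case: (g _) => s t; rewrite le_prodE !elt_lo_le.
have f1 : f (elt_hi I, elt_hi J) = elt_hi K.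
  apply/le_anti; rewrite le_elt_hi /= -{1}[elt_hi K]gK fM.
  by case: (g _) => s t; rewrite le_prodE !le_elt_hi.
have utop : val u = pp_top k -> cls J = one_cls.
  move=> e; apply: lo_hi_one; have : u = elt_hi K by apply: val_inj.
  by rewrite -f1 => /(can_inj fK)/(congr1 snd).
have vtop : val v = pp_top k -> cls I = one_cls.
  move=> e; apply: lo_hi_one; have : v = elt_hi K by apply: val_inj.
  by rewrite -f1 => /(can_inj fK)/(congr1 fst).
pose U := val u; pose V := val v.
have UV z : (z <= U)%O -> (z <= V)%O -> z = pp_bot k.+1.
  move=> zU zV; have zin : (pp_bot k.+1 <= z <= pp_top k)%O.
    by rewrite le_bot (le_trans zU (le_hi u)).
  pose z' : elts K := @Elt K _ zin.
  have zu : (z' <= u)%O by [].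
  have zv : (z' <= v)%O by [].
  move: zu zv; rewrite -[z']gK /u /v !fM.
  case e: (g z') => [s t]; rewrite !le_prodE => /andP[_ t0] /andP[s0 _].
  have {}t0 : t = elt_lo J by apply/le_anti; rewrite t0 elt_lo_le.
  have {}s0 : s = elt_lo I by apply/le_anti; rewrite s0 elt_lo_le.
  by rewrite -f0 -s0 -t0 -e gK.
have atomUV i j : i != ord0 -> i != j -> (merge i j <= U)%O || (merge i j <= V)%O.
  move=> i0 ij; have zin : (pp_bot k.+1 <= merge i j <= pp_top k)%O.
    by rewrite le_bot merge_top.
  pose z' : elts K := @Elt K _ zin.
  case e: (g z') => [s t]; have ez : f (s, t) = z' by rewrite -e gK.
  (* Below the atom z' = f (s, t), the element f (s, 0) is either z' itself, which is then below
     [u], or the bottom, so that s = 0 and z' is below [v]. *)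
  have: (f (s, elt_lo J) <= z')%O by rewrite -ez fM le_prodE lexx elt_lo_le.
  case/merge_min => // h.
    have {}h : f (s, elt_lo J) = z' by apply: val_inj.
    apply/orP; left; change (z' <= u)%O.
    by rewrite -h fM le_prodE le_elt_hi lexx.
  have /(can_inj fK)/(congr1 fst)/= s0 : f (s, elt_lo J) = f (elt_lo I, elt_lo J).
    by apply: val_inj; rewrite f0.
  apply/orP; right; change (z' <= v)%O.
  by rewrite -ez s0 fM le_prodE le_elt_hi lexx.
have U0 : pt U ord0 = ord0 by apply/eqP; rewrite -le_top_pt; apply: (le_hi u).
have V0 : pt V ord0 = ord0 by apply/eqP; rewrite -le_top_pt; apply: (le_hi v).
(* If merge i 0 <= U and merge j 0 <= V, then U or V contains both: it is the one *)
(* above merge i j or the other.                                                  *)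
have excl i j : i != ord0 -> j != ord0 ->
    (merge i ord0 <= U)%O -> (merge j ord0 <= V)%O -> False.
  move=> i0 j0 iU jV.
  have ij : i != j.
    by apply: contraTneq jV => <-; apply/negP => /(UV _ iU)/eqP; apply/negP/merge_neq_bot.
  have [Ui _] := merge_leP i0 _ iU; have [Vj _] := merge_leP j0 _ jV.
  case/orP: (atomUV i j i0 ij) => /(merge_leP ij)[e _].
    have jU : (merge j ord0 <= U)%O.
      by apply/(merge_leP j0); rewrite -e Ui U0 eq_sym.
    by have /eqP := UV _ jU jV; apply/negP/merge_neq_bot.
  have iV : (merge i ord0 <= V)%O.
    by apply/(merge_leP i0); rewrite e Vj V0 eq_sym.
  by have /eqP := UV _ iU iV; apply/negP/merge_neq_bot.
(* By [excl], one atom [merge j ord0] below [V] keeps all of them from being below [U], so all are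
   below [V]. *)
have [/existsP[j /andP[j0 jV]]|/existsPn noV] :=
    boolP [exists j, (j != ord0) && (merge j ord0 <= V)%O].
  left; apply/vtop/top_of_merge => [|i i0]; first exact: (le_hi v).
  by case/orP: (atomUV i ord0 i0 i0) => // iU; case: (excl i j).
right; apply/utop/top_of_merge => [|i i0]; first exact: (le_hi u).
by case/orP: (atomUV i ord0 i0 i0) => // iV; have := noV i; rewrite i0 iV.
Qed.

Definition ccard (c : iclass) : nat := #|{: elts (rep c)}|.

Lemma ccard_icls n (a b : ppart n.+1) : (a <= b)%O ->
  ccard (icls a b) = #|[set x : ppart n.+1 | (a <= x <= b)%O]|.
Proof.
move=> ab; have := csum_icls addn (fun _ _ => 1)%N ab.
by rewrite /csum sum1_card sum1dep_card => <-; apply: eq_card.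
Qed.

Lemma ccard_upper n (a x b : ppart n.+1) : (a <= x)%O -> (x <= b)%O ->
  (ccard (icls x b) <= ccard (icls a b) ?= iff (x == a))%N.
Proof.
move=> ax xb; rewrite !ccard_icls ?(le_trans ax) //; split.
  apply/subset_leq_card/subsetP => y; rewrite !inE => /andP[xy ->].
  by rewrite (le_trans ax xy).
have [->|xa] := eqVneq x a; first by rewrite eqxx.
apply/negbTE; rewrite neq_ltn; apply/orP; left; apply/proper_card/properP; split.
  apply/subsetP => y; rewrite !inE => /andP[xy ->].
  by rewrite (le_trans ax xy).
exists a; first by rewrite inE lexx (le_trans ax).
by rewrite inE; apply/negP => /andP[xa' _]; rewrite eq_le ax xa' in xa.
Qed.

Lemma points_top m : points (pp_top m) = [set ord0].
Proof. by apply/setP => i; rewrite point_pt pt_top inE eq_sym. Qed.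

Lemma icls_top m (a : ppart m.+1) : (a <= pp_top m)%O ->
  icls a (pp_top m) = pic #|points a|.-1.
Proof.
move=> am; rewrite icls_pic // points_top big_set1; congr (pic _.-1).
by apply: eq_card => i; rewrite !inE pt_top eqxx andbT.
Qed.

Lemma icls_bot n (b : ppart n.+1) :
  icls (pp_bot n.+1) b = \big[mmul/mone]_(p in points b) pic #|[set q | pt b q == p]|.-1.
Proof.
rewrite icls_pic ?le_bot //; apply: eq_bigr => p _; congr (pic _.-1).
by apply: eq_card => i; rewrite [LHS]inE [RHS]inE point_pt pt_bot eqxx.
Qed.

(** Pi_{m+1,1} is the proper upper interval of Pi_{m+2,1} above the atom that merges the last
    element with the pointed one. *)
Lemma ccard_pic_lt k m : (k < m)%N -> (ccard (pic k) < ccard (pic m))%N.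
Proof.
elim: m => // m IH; rewrite ltnS leq_eqVlt => /predU1P[->|/IH km].
all: suff h : (ccard (pic m) < ccard (pic m.+1))%N by rewrite ?(ltn_trans km).
all: pose i : 'I_m.+2 := ord_max.
all: have i0 : i != ord0 by [].
all: have at_top := merge_top i0 i0.
all: have -> : pic m = icls (merge i ord0) (pp_top m.+1).
all: try (rewrite (ltn_leqif (ccard_upper (le_bot _) at_top)); exact: merge_neq_bot).
all: rewrite icls_top //; congr pic.
all: have -> : points (merge i ord0) = [set~ i].
all: try by rewrite cardsC1 card_ord.
all: apply/setP => t; rewrite point_pt !inE pt_merge //.
all: by have [->|_] := eqVneq t i; rewrite ?eqxx // eq_sym.
Qed.

Definition upper_count k (c : iclass) : nat := csum addn (fun _ d => d == pic k : nat) c.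

Lemma pic_eq1 k : (pic k == one_cls) = (k == 0)%N.
Proof.
rewrite icls_eq1 ?le_bot //; apply/eqP/eqP => [e|->]; last first.
  by apply: pt_inj => i; rewrite pt_bot pt_top ord1.
have := pt_top (@ord_max k); rewrite -e pt_bot => /(congr1 val) /=; exact.
Qed.

Lemma upper_count_one_cls c : csum addn (fun _ d => d == one_cls : nat) c = 1%N.
Proof.
elim/icls_ind: c => n a b ab.
rewrite (csum_icls _ _ ab) (bigD1 b) /=; last by rewrite ab lexx.
rewrite icls_refl eqxx big1 ?addn0 // => x /andP[/andP[_ xb] xNb].
by rewrite icls_eq1 // (negbTE xNb).
Qed.

(** An upper interval of a product is a product of upper intervals. By irreducibility it has class
    [pic k] exactly when one factor does and the other is trivial, and every class has a single
    trivial upper interval. For k > 0 the two cases are exclusive. *)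
Lemma upper_countM k c d : (0 < k)%N ->
  upper_count k (mmul c d) = (upper_count k c + upper_count k d)%N.
Proof.
move=> k0; rewrite /upper_count csum_mul.
have h e e' : (mmul e e' == pic k) =
    ((e == pic k) * (e' == one_cls) + (e == one_cls) * (e' == pic k))%N :> nat.
  have kN1 : (one_cls == pic k) = false by rewrite eq_sym pic_eq1; apply/negbTE; rewrite -lt0n.
  have [->|eN1] := eqVneq e one_cls.
    by rewrite (mul_1cls e' : mmul one_cls e' = e') kN1 mul1n.
  have [->|e'N1] := eqVneq e' one_cls.
    by rewrite (mul_cls1 e : mmul e one_cls = e) kN1 muln1 muln0 addn0.
  rewrite muln0 mul0n; case: (mmul e e' =P _) => // /pic_irreducible[] /eqP.
    by rewrite (negbTE eN1).
  by rewrite (negbTE e'N1).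
pose A e := (e == pic k : nat); pose B e := (e == one_cls : nat).
transitivity (\sum_(x : elts (rep c)) \sum_(y : elts (rep d))
   (A (cls (upper x)) * B (cls (upper y)) + B (cls (upper x)) * A (cls (upper y))))%N.
  by apply: eq_bigr => x _; apply: eq_bigr => y _; rewrite h.
have cE : (\sum_(x : elts (rep c)) B (cls (upper x)) = 1)%N := upper_count_one_cls c.
have dE : (\sum_(x : elts (rep d)) B (cls (upper x)) = 1)%N := upper_count_one_cls d.
transitivity (\sum_(x : elts (rep c)) (A (cls (upper x)) * 1 +
    B (cls (upper x)) * upper_count k d))%N.
  apply: eq_bigr => x _; rewrite big_split /=; congr addn.
    by rewrite -big_distrr /= dE.
  by rewrite -big_distrr.
rewrite big_split /=; congr addn; first by rewrite -big_distrl /= muln1.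
by rewrite -big_distrl /= cE mul1n.
Qed.

(** Upper intervals of [pic m] have too few elements to be of class [pic k]. *)
Lemma upper_count_lt k m : (m < k)%N -> upper_count k (pic m) = 0%N.
Proof.
move=> mk; rewrite /upper_count csum_icls ?le_bot // big1 // => x /andP[_ xm].
apply/eqP; rewrite eqb0; apply/eqP => e.
have := (ccard_upper (le_bot x) xm).1; rewrite e leqNgt.
by have := ccard_pic_lt mk => ->.
Qed.

(** Only the bottom element has an upper interval of full cardinality. *)
Lemma upper_count_pic k : upper_count k (pic k) = 1%N.
Proof.
rewrite /upper_count csum_icls ?le_bot // (bigD1 (pp_bot _)) /=; last first.
  by rewrite lexx le_bot.
rewrite eqxx big1 ?addn0 // => x /andP[/andP[_ xm] xN].
apply/eqP; rewrite eqb0; apply: contraNneq xN => e.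
have := eq_leqif (ccard_upper (le_bot x) xm).
by rewrite e -/(pic k) eqxx => <-.
Qed.

(** * The monoid of classes is free commutative *)

Section FreeGenerators.
Local Notation mon := {cmonom gen_index}.

Definition theta (m : mon) : iclass :=
  \big[mmul/mone]_(i <- finsupp m) iter (m i) (mmul (pic (val i).-1)) mone.

Lemma thetaEw (m : mon) (D : {fset gen_index}) : (finsupp m `<=` D)%fset ->
  theta m = \big[mmul/mone]_(i <- D) iter (m i) (mmul (pic (val i).-1)) mone.
Proof.
move=> sD; rewrite /theta (big_fset_incl _ sD) // => i _.
by rewrite -cmE_eq0 => /eqP->.
Qed.

Lemma theta1 : theta mone = mone.
Proof. by rewrite /theta mdom1 big_seq_fset0. Qed.

Lemma iter_mmul (M : conomType) (x y : M) j : iter j (mmul x) y = mmul (iter j (mmul x) mone) y.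
Proof. by elim: j => [|j IH] /=; rewrite ?mul1m // IH mulmA. Qed.

Lemma thetaM m n : theta (mmul m n) = mmul (theta m) (theta n).
Proof.
rewrite {1}/theta mdomD (thetaEw (fsubsetUl _ (finsupp n) : finsupp m `<=` _)%fset).
rewrite (thetaEw (fsubsetUr (finsupp m) _ : finsupp n `<=` _)%fset) -big_split /=.
by apply: eq_bigr => i _; rewrite cmM iterD iter_mmul.
Qed.

(** Same convention as [gen]: index 1 gives the unit, which matches the trivial class [pic 0]. *)
Definition mgen (n : nat) : mon :=
  if @insub _ (fun n => 1 < n)%N gen_index n is Some i then ucm i else mone.

Lemma theta_mgen n : theta (mgen n.+1) = pic n.
Proof.
rewrite /mgen; case: insubP => [i i1 iE|].
  rewrite /theta mdomU big_seq_fset1 cmUU /= mulm1.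
  by rewrite (_ : \val i = n.+1).
by rewrite -leqNgt ltnS leqn0 => /eqP->; rewrite theta1; apply/esym/eqP; rewrite pic_eq1.
Qed.

Lemma upper_count_theta k (m : mon) (D : {fset gen_index}) : (0 < k)%N ->
  (finsupp m `<=` D)%fset ->
  upper_count k (theta m) = (\sum_(i <- D) m i * upper_count k (pic (val i).-1))%N.
Proof.
move=> k0 sD; rewrite (thetaEw sD).
have h1 : upper_count k mone = 0%N.
  by rewrite -(upper_count_lt k0); congr upper_count; apply/esym/eqP; rewrite pic_eq1.
rewrite (big_morph (upper_count k) (fun c d => upper_countM c d k0) h1).
apply: eq_bigr => i _; elim: (m i) => [|j IH]; first by rewrite mul0n.
by rewrite iterS upper_countM // IH mulSn.
Qed.

(** The counts [upper_count] depend linearly on the exponents, through a unitriangular matrix. The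
    induction on [B - val i] recovers the exponents from the largest index downwards: larger indices
    agree by induction, and smaller ones contribute 0. *)
Lemma theta_inj : injective theta.
Proof.
move=> m n e; pose D := (finsupp m `|` finsupp n)%fset.
have [sm sn] : (finsupp m `<=` D)%fset /\ (finsupp n `<=` D)%fset.
  by rewrite fsubsetUl fsubsetUr.
apply/eqP/cmP => i; pose B := (\max_(j <- D) val j).+1.
have [N] := ubnP (B - val i); elim: N i => // N IH i lt_i.
have [iD|/negbTE iND] := boolP (i \in D); last first.
  by move/negbT: iND; rewrite in_fsetU negb_or -!cmE_eq0 => /andP[/eqP-> /eqP->].
have iB : (val i < B)%N by rewrite ltnS; apply: leq_bigmax_seq.
have i0 : (0 < (val i).-1)%N by case: (val i) (valP i) => [|[]].
have := congr1 (upper_count (val i).-1) e.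
rewrite (upper_count_theta i0 sm) (upper_count_theta i0 sn).
rewrite !(big_rem i iD) /= upper_count_pic !muln1.
suff -> : (\sum_(j <- rem i D) m j * upper_count (val i).-1 (pic (val j).-1) =
    \sum_(j <- rem i D) n j * upper_count (val i).-1 (pic (val j).-1))%N by move/addIn.
rewrite big_seq [RHS]big_seq; apply: eq_bigr => j.
rewrite mem_rem_uniq ?fset_uniq // inE => /andP[ji jD].
have [ij|ij|/val_inj ij] := ltngtP (val i) (val j); last by rewrite ij eqxx in ji.
  rewrite IH // (leq_trans _ (_ : B - val i <= N)%N) //.
  by rewrite ltn_sub2l.
have j1 := valP j.
by rewrite upper_count_lt ?muln0 //; case: (val j) j1 ij => [|a] //; case: (val i).
Qed.

(** The factorization of [icls_pic], read off a representative. *)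
Definition expo (c : iclass) : mon :=
  \big[mmul/mone]_(p in points (hi (rep c)))
    mgen #|[set q in points (lo (rep c)) | pt (hi (rep c)) q == p]|.

Lemma thetaK : cancel expo theta.
Proof.
move=> c; rewrite -{2}(icls_rep c).
rewrite /expo; set a := lo _; set b := hi _; have ab : (a <= b)%O by exact: lo_le_hi.
rewrite (big_morph theta thetaM theta1) icls_pic //; apply: eq_bigr => p pb.
rewrite -theta_mgen prednK // card_gt0; apply/set0Pn; exists p.
have bp : pt b p = p by apply/eqP; rewrite -point_pt.
by rewrite inE bp eqxx point_pt andbT -{1}bp (ppart_leP _ _ ab p).2 bp.
Qed.

Lemma expoK : cancel theta expo.
Proof. by move=> m; apply: theta_inj; rewrite thetaK. Qed.

Lemma expo1 : expo mone = mone.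
Proof. by apply: theta_inj; rewrite thetaK theta1. Qed.

Lemma expoM c d : expo (mmul c d) = mmul (expo c) (expo d).
Proof. by apply: theta_inj; rewrite thetaM !thetaK. Qed.

Lemma expo_pic n : expo (pic n) = mgen n.+1.
Proof. by apply: theta_inj; rewrite thetaK theta_mgen. Qed.

Lemma mgenE k n : gen k n = << mgen n >>.
Proof. by rewrite /gen /mgen; case: insub. Qed.
End FreeGenerators.

(** * The incidence Hopf algebra *)

Section LinearOnBasis.
Variable k : fieldType.
Implicit Types M N P : conomType.

Definition mbas M (m : M) : {malg k[M]} := << m >>.
Local Notation bas := (@mbas _).

Lemma malg_bas M (u : {malg k[M]}) : u = \sum_(m <- msupp u) u@_m *: bas m.
Proof. exact: malg_lin. Qed.

Lemma basM M (m n : M) : bas m * bas n = bas (mmul m n).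
Proof. exact: malgUM. Qed.

Lemma bas1 M : bas (mone : M) = 1.
Proof. by []. Qed.

Lemma lin_ext_bas M (V : lmodType k) (h : M -> V) m : lin_ext h (bas m) = h m.
Proof. exact: lin_extU. Qed.

Lemma tens_bas M N (m : M) (n : N) : tens (bas m) (bas n) = bas (m, n).
Proof. exact: tensU. Qed.

Lemma lin_on_basis M (V : lmodType k) (f g : {malg k[M]} -> V) : linear f -> linear g ->
  (forall m, f (bas m) = g (bas m)) -> f =1 g.
Proof.
move=> fl gl fg u.
pose f' : {linear {malg k[M]} -> V} := HB.pack f (GRing.isLinear.Build k _ _ *:%R f fl).
pose g' : {linear {malg k[M]} -> V} := HB.pack g (GRing.isLinear.Build k _ _ *:%R g gl).
rewrite -[f]/(f' : _ -> _) -[g]/(g' : _ -> _) [u]malg_bas !linear_sum.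
by apply: eq_bigr => m _; rewrite !linearZ /= fg.
Qed.

Section Tens.
Variables M N : conomType.
Implicit Types (u : {malg k[M]}) (v : {malg k[N]}).

Lemma tens_is_linearl v : linear (fun u => tens u v).
Proof. exact: lin_ext_is_linear. Qed.

Lemma tens_is_linearr u : linear (tens u : {malg k[N]} -> _).
Proof.
move=> c v w; rewrite /tens /lin_ext scaler_sumr -big_split /=.
by apply: eq_bigr => m _; rewrite -/(lin_ext _ _) linearP scalerDr !scalerA mulrC.
Qed.

HB.instance Definition _ u := GRing.isLinear.Build k {malg k[N]} {malg k[(M * N)%type]}
  *:%R (tens u) (tens_is_linearr u).

Definition tensl v u : {malg k[(M * N)%type]} := tens u v.
HB.instance Definition _ v := GRing.isLinear.Build k {malg k[M]} {malg k[(M * N)%type]}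
  *:%R (tensl v) (tens_is_linearl v).

Lemma tens_suml I (r : seq I) (P : pred I) (F : I -> {malg k[M]}) v :
  tens (\sum_(i <- r | P i) F i) v = \sum_(i <- r | P i) tens (F i) v.
Proof. exact: (linear_sum (tensl v)). Qed.

Lemma tens_sumr I (r : seq I) (P : pred I) u (F : I -> {malg k[N]}) :
  tens u (\sum_(i <- r | P i) F i) = \sum_(i <- r | P i) tens u (F i).
Proof. exact: linear_sum. Qed.
End Tens.

HB.instance Definition _ M N M' N' (f : {malg k[M]} -> {malg k[M']})
    (g : {malg k[N]} -> {malg k[N']}) := GRing.Linear.copy (tens_map f g) (lin_ext _).
HB.instance Definition _ M N P := GRing.Linear.copy (@tens_assoc k M N P) (lin_ext _).
HB.instance Definition _ M (f g : {malg k[M]} -> {malg k[M]}) :=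
  GRing.Linear.copy (tens_mul f g) (lin_ext _).

Lemma tens_map_bas M N M' N' (f : {malg k[M]} -> {malg k[M']}) (g : {malg k[N]} -> {malg k[N']})
  x : tens_map f g (bas x) = tens (f (bas x.1)) (g (bas x.2)).
Proof. exact: lin_ext_bas. Qed.

Lemma tens_assoc_bas M N P x : @tens_assoc k M N P (bas x) = bas (x.1.1, (x.1.2, x.2)).
Proof. exact: lin_ext_bas. Qed.

Lemma tens_mul_bas M (f g : {malg k[M]} -> {malg k[M]}) x :
  tens_mul f g (bas x) = f (bas x.1) * g (bas x.2).
Proof. exact: lin_ext_bas. Qed.

Lemma tens_mul_sum M (f g : {malg k[M]} -> {malg k[M]}) I (r : seq I) (P : pred I)
    (F : I -> (M * M)%type) :
  tens_mul f g (\sum_(i <- r | P i) bas (F i)) =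
  \sum_(i <- r | P i) f (bas (F i).1) * g (bas (F i).2).
Proof. by rewrite (linear_sum (tens_mul f g)); apply: eq_bigr => i _; apply: tens_mul_bas. Qed.

Lemma counit_is_morphism M :
  algebra_morphism (lin_ext (V := k^o) (fun m : M => (m == mone)%:R)).
Proof.
apply: lin_ext_morphism => [|m n]; first by rewrite eqxx.
have [->|mN1] := eqVneq m mone; first by rewrite mul1m mul1r.
have [/unitm[/eqP]|_] := eqVneq (mmul m n) mone; first by rewrite (negbTE mN1).
by rewrite mul0r.
Qed.

Lemma scalar_is_linear M : linear (fun c : k^o => c%:MP : {malg k[M]}).
Proof.
by move=> c x y; rewrite monalgUD -mul_malgC -mpolyCM.
Qed.

End LinearOnBasis.

Lemma ccard_lower n (a x b : ppart n.+1) : (a <= x)%O -> (x < b)%O ->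
  (ccard (icls a x) < ccard (icls a b))%N.
Proof.
move=> ax xb; rewrite !ccard_icls ?(le_trans ax (ltW xb)) //.
apply/proper_card/properP; split.
  apply/subsetP => y; rewrite !inE => /andP[-> yx].
  by rewrite (le_trans yx (ltW xb)).
exists b; first by rewrite inE lexx (le_trans ax (ltW xb)).
by rewrite inE (lt_geF xb) andbF.
Qed.

(** * Convolution inverses by recursion on intervals *)

Section Antipode.
Variables (A : comNzRingType) (w : iclass -> A).
Hypothesis w1 : w one_cls = 1.

(* N is a bound on the cardinality of c, see antipode_rec_stable. *)
Fixpoint antipode_rec N (c : iclass) : A :=
  if N is N'.+1 then
    if c == one_cls then 1 else
    - csum +%R (fun d e => if e == one_cls then 0 else antipode_rec N' d * w e) c
  else 1.

(** Recursive calls concern [a, x] with x < b, which has fewer elements than [a, b]. The bound 0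
    never occurs, intervals being non-empty. *)
Lemma antipode_rec_stable N N' c : (ccard c <= N)%N -> (ccard c <= N')%N ->
  antipode_rec N c = antipode_rec N' c.
Proof.
elim/icls_ind: c => n a b.
have c0 (x y : ppart n.+1) : (x <= y)%O -> (ccard (icls x y) <= 0)%N = false.
  move=> xy; apply/negbTE; rewrite -ltnNge ccard_icls // card_gt0; apply/set0Pn.
  by exists x; rewrite inE lexx xy.
elim: N N' a b => [|N IH] N' a b ab; first by rewrite c0.
case: N' => [|N']; first by rewrite c0.
move=> cN cN' /=; rewrite !(csum_icls _ _ ab); case: ifP => [//|_].
apply: (congr1 -%R); apply: eq_bigr => x /andP[ax xb]; rewrite (icls_eq1 xb).
have [//|xNb] := eqVneq x b; apply: (congr1 ( *%R^~ _)).
have lt_xb : (x < b)%O by rewrite lt_neqAle xNb.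
by apply: IH => //; rewrite -ltnS (leq_trans (ccard_lower ax lt_xb)).
Qed.

Definition antipode_cls c : A := antipode_rec (ccard c) c.

(** For a < b, the term x = b is defined by the recursion as the opposite of the sum of the other
    terms. *)
Lemma antipode_cls_left n (a b : ppart n.+1) : (a <= b)%O ->
  \sum_(x | (a <= x <= b)%O) antipode_cls (icls a x) * w (icls x b) = (a == b)%:R.
Proof.
move=> ab; have [->|aNb] := eqVneq a b.
  rewrite (big_pred1 b) => [|x]; last by rewrite -eq_le eq_sym.
  rewrite !icls_refl w1 /antipode_cls.
  by case: (ccard _) => [|N] /=; rewrite ?eqxx mul1r.
rewrite (bigD1 b) /=; last by rewrite lexx ab.
rewrite icls_refl w1 mulr1; apply/eqP; rewrite addr_eq0; apply/eqP.
have cE : ccard (icls a b) = (ccard (icls a b)).-1.+1.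
  by rewrite (ltn_predK (ccard_lower (lexx a) _)) // lt_neqAle aNb.
rewrite {1}/antipode_cls cE /= icls_eq1 // (negbTE aNb) (csum_icls _ _ ab); apply: (congr1 -%R).
rewrite (bigD1 b) /=; last by rewrite lexx ab.
rewrite icls_refl eqxx add0r; apply: eq_bigr => x /andP[/andP[ax xb] xNb].
rewrite (icls_eq1 xb) (negbTE xNb) /antipode_cls; apply: (congr1 ( *%R^~ _)).
apply: antipode_rec_stable => //; rewrite -ltnS -cE ccard_lower //.
by rewrite lt_neqAle xNb.
Qed.

(* In the incidence algebra of ppart n.+1, realised as matrices, a left inverse is *)
(* also a right inverse.                                                           *)
Lemma antipode_cls_right n (a b : ppart n.+1) : (a <= b)%O ->
  \sum_(x | (a <= x <= b)%O) w (icls a x) * antipode_cls (icls x b) = (a == b)%:R.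
Proof.
pose T := ppart n.+1; pose e (i : 'I_#|{: T}|) : T := enum_val i.
pose mx (h : iclass -> A) : 'M[A]_#|{: T}| :=
  \matrix_(i, j) if (e i <= e j)%O then h (icls (e i) (e j)) else 0.
have mulE h h' x y : (mx h *m mx h') (enum_rank x) (enum_rank y) =
    \sum_(z | (x <= z <= y)%O) h (icls x z) * h' (icls z y).
  rewrite mxE [RHS]big_mkcond /=.
  pose F z := (if (x <= z)%O then h (icls x z) else 0) *
              (if (z <= y)%O then h' (icls z y) else 0).
  transitivity (\sum_(i < #|{: T}|) F (enum_val i)).
    by apply: eq_bigr => i _; rewrite !mxE /e !enum_rankK.
  rewrite -big_enum_val; apply: eq_big => // z _; rewrite /F.
  by case: ifP => // _; case: ifP => // _; rewrite ?mulr0 ?mul0r.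
have inv : mx antipode_cls *m mx w = 1%:M.
  apply/matrixP => i j; rewrite -(enum_valK i) -(enum_valK j) mulE !mxE.
  rewrite (can_eq enum_rankK); have [xy|xy] := boolP (enum_val i <= enum_val j)%O.
    exact: antipode_cls_left.
  rewrite big_pred0 => [|z].
    by case: eqVneq xy => // ->; rewrite lexx.
  by apply/negP => /andP[xz /(le_trans xz)]; apply/negP.
move=> ab; rewrite -(mulE w antipode_cls) (mulmx1C inv) mxE.
by rewrite (can_eq enum_rankK).
Qed.
End Antipode.

Section IncidenceHopf.
Variable k : fieldType.
Local Notation A := {malg k[iclass]}.
Local Notation bas := (@mbas k _).
Local Notation Delta := (@inc_comul k).
Local Notation eps := (@inc_counit k).

HB.instance Definition _ := GRing.Linear.copy Delta (lin_ext _).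
HB.instance Definition _ := GRing.Linear.copy (eps : A -> k^o) (lin_ext _).

Lemma inc_comul_bas c :
  Delta (bas c) = csum +%R (fun d e => bas (d, e)) c.
Proof. exact: lin_ext_bas. Qed.

Lemma inc_comul_icls n (a b : ppart n.+1) : (a <= b)%O ->
  Delta (bas (icls a b)) = \sum_(x | (a <= x <= b)%O) bas (icls a x, icls x b).
Proof. by move=> ab; rewrite inc_comul_bas csum_icls. Qed.

Lemma inc_counit_icls n (a b : ppart n.+1) : (a <= b)%O ->
  eps (bas (icls a b)) = (a == b)%:R.
Proof. by move=> ab; rewrite /inc_counit lin_ext_bas icls_eq1. Qed.

Lemma inc_comul_morphism : algebra_morphism Delta.
Proof.
have h c : comul_itv k (rep c) = Delta (bas c) by rewrite /inc_comul lin_ext_bas.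
apply: lin_ext_morphism => [|c d]; rewrite h.
  rewrite (_ : mone = icls (pp_bot 1) (pp_bot 1)); last by rewrite icls_refl.
  rewrite (inc_comul_icls (lexx _)) (big_pred1 (pp_bot 1)) ?icls_refl // => x.
  by rewrite -eq_le eq_sym.
rewrite inc_comul_bas csum_mul /comul_itv big_distrlr /=.
by apply: eq_bigr => x _; apply: eq_bigr => y _; rewrite basM.
Qed.

Lemma inc_counit_scalar n (a b : ppart n.+1) : (a <= b)%O ->
  (eps (bas (icls a b)))%:MP = (a == b)%:R :> A.
Proof. by move=> ab; rewrite inc_counit_icls // mpolyC_nat. Qed.

(** Both sides are the sum of [a, y] (x) [y, x] (x) [x, b] over the chains a <= y <= x <= b. *)
Lemma inc_coassoc u :
  tens_assoc (tens_map Delta id (Delta u)) = tens_map id Delta (Delta u).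
Proof.
apply: (lin_on_basis (f := fun u => tens_assoc (tens_map Delta id (Delta u)))
  (g := fun u => tens_map id Delta (Delta u))) u => [c u v|c u v|c].
- by rewrite !linearP.
- by rewrite !linearP.
elim/icls_ind: c => n a b ab; rewrite inc_comul_icls //.
rewrite (linear_sum (tens_map Delta id)) (linear_sum (tens_map id Delta)) linear_sum.
transitivity (\sum_(x | (a <= x <= b)%O) \sum_(y | (a <= y <= x)%O)
    bas (icls a y, (icls y x, icls x b))).
  apply: eq_bigr => x /andP[ax xb].
  rewrite /= tens_map_bas inc_comul_icls // tens_suml (linear_sum (@tens_assoc k _ _ _)).
  by apply: eq_bigr => y _; rewrite tens_bas; apply: tens_assoc_bas.
rewrite (exchange_big_dep (fun y => (a <= y <= b)%O)) /=; last first.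
  by move=> x y /andP[ax xb] /andP[-> yx]; rewrite (le_trans yx).
apply: eq_bigr => y /andP[ay yb]; rewrite tens_map_bas inc_comul_icls // tens_sumr.
apply: eq_big => [x|x _]; last by rewrite tens_bas.
rewrite ay /=; apply/andP/andP => [[/andP[_ ->] ->]|[yx ->]] //.
by rewrite yx (le_trans ay yx).
Qed.

Lemma inc_counitl u : tens_mul (fun v => (eps v)%:MP) id (Delta u) = u.
Proof.
apply: (lin_on_basis (f := fun u => tens_mul (fun v => (eps v)%:MP) id (Delta u))
  (g := id)) u => [c u v|//|c]; first by rewrite !linearP.
elim/icls_ind: c => n a b ab; rewrite inc_comul_icls // tens_mul_sum.
transitivity (\sum_(x | (a <= x <= b)%O) if x == a then bas (icls a b) else 0).
  apply: eq_bigr => x /andP[ax _] /=; rewrite inc_counit_scalar // eq_sym.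
  by case: eqP => [->|_]; rewrite ?mul1r ?mul0r.
rewrite -big_mkcondr (big_pred1 a) // => x.
by rewrite /= andbC; case: eqP => //= ->; rewrite lexx ab.
Qed.

Lemma inc_counitr u : tens_mul id (fun v => (eps v)%:MP) (Delta u) = u.
Proof.
apply: (lin_on_basis (f := fun u => tens_mul id (fun v => (eps v)%:MP) (Delta u))
  (g := id)) u => [c u v|//|c]; first by rewrite !linearP.
elim/icls_ind: c => n a b ab; rewrite inc_comul_icls // tens_mul_sum.
transitivity (\sum_(x | (a <= x <= b)%O) if x == b then bas (icls a b) else 0).
  apply: eq_bigr => x /andP[_ xb] /=; rewrite inc_counit_scalar //.
  by case: eqP => [->|_]; rewrite ?mulr1 ?mulr0.
rewrite -big_mkcondr (big_pred1 b) // => x.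
by rewrite /= andbC; case: eqP => //= ->; rewrite lexx ab.
Qed.

Lemma inc_is_Hopf : is_Hopf_algebra Delta eps.
Proof.
have scal : linear (fun u : A => (eps u)%:MP : A).
  by move=> c u v; rewrite (linearP (eps : A -> k^o)) scalar_is_linear.
split.
- exact: inc_comul_morphism.
- exact: counit_is_morphism.
- exact: inc_coassoc.
- exact: inc_counitl.
- exact: inc_counitr.
(* The antipode is the convolution inverse of the identity, so [w] is taken to be the basis
   embedding. *)
exists (lin_ext (antipode_cls (fun c => bas c))); split; first exact: lin_ext_is_linear.
  apply: lin_on_basis => [c u v|//|c]; first by rewrite !linearP.
  elim/icls_ind: c => n a b ab; rewrite inc_comul_icls // tens_mul_sum inc_counit_scalar //.
  apply: etrans (antipode_cls_left (w := fun c => bas c) (bas1 _ _) ab).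
  by apply: eq_bigr => x _; rewrite lin_ext_bas.
apply: lin_on_basis => [c u v|//|c]; first by rewrite !linearP.
elim/icls_ind: c => n a b ab; rewrite inc_comul_icls // tens_mul_sum inc_counit_scalar //.
apply: etrans (antipode_cls_right (w := fun c => bas c) (bas1 _ _) ab).
by apply: eq_bigr => x _; rewrite lin_ext_bas.
Qed.
End IncidenceHopf.

(** * Enumeration of pointed partitions *)

Section FiberSum.
Variables (k : fieldType) (A : comAlgType k).
Hypothesis k0 : [pchar k] =i pred0.

Lemma natr_fact_neq0 n : n`!%:R != 0 :> k.
Proof. by rewrite ((pcharf0P k).1 k0) -lt0n fact_gt0. Qed.

Lemma natr_bin_fact n j : (j <= n)%N ->
  'C(n, j)%:R * (n - j)`!%:R = n`!%:R / j`!%:R :> k.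
Proof.
move=> jn; apply: (mulIf (natr_fact_neq0 j)).
by rewrite divfK ?natr_fact_neq0 // -!natrM -(bin_fact jn) -mulnA [(j`! * _)%N]mulnC.
Qed.

(* The maps U -> S, extended by the identity outside U. *)
Definition maps_to (T : finType) (U S : {set T}) (h : {ffun T -> T}) :=
  [forall i, if i \in U then h i \in S else h i == i].

Lemma maps_toP (T : finType) (U S : {set T}) (h : {ffun T -> T}) :
  reflect ((forall i, i \in U -> h i \in S) /\ (forall i, i \notin U -> h i = i))
          (maps_to U S h).
Proof.
apply: (iffP forallP) => [H|[H1 H2] i]; last first.
  by case: ifPn => [/H1//|/H2->].
split=> i; first by move=> iU; have := H i; rewrite iU.
by move=> /negbTE iU; have := H i; rewrite iU => /eqP.
Qed.

Lemma sum_subsets (T : finType) (U : {set T}) (F : nat -> A) :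
  \sum_(V : {set T} | V \subset U) F #|V| = \sum_(j < #|U|.+1) 'C(#|U|, j)%:R *: F j.
Proof.
rewrite (partition_big (fun V : {set T} => inord #|V| : 'I_#|U|.+1) predT) //=.
apply: eq_bigr => j _; rewrite -cards_draws.
rewrite (eq_bigl [in [set V : {set T} | V \subset U & #|V| == j]]); last first.
  move=> V; rewrite inE; case: (boolP (V \subset U)) => //= VU.
  by rewrite -val_eqE /= inordK // ltnS subset_leq_card.
rewrite (eq_bigr (fun=> F j)) => [|V]; last by rewrite inE => /andP[_ /eqP->].
by rewrite sumr_const scaler_nat.
Qed.

(** The exponential generating function of [w], truncated; only coefficients of index less than [L]
    are read off its powers. *)
Definition exp_poly (w : nat -> A) L : {poly A} := \poly_(i < L) ((i`!%:R)^-1 *: w i).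

(* Induction on S: fixing the fiber V of one element q of S leaves a map from U :\: V *)
(* to S :\ q, so the sum is a binomial convolution.                                  *)
Lemma sum_maps_to (T : finType) (w : nat -> A) L (U S : {set T}) :
  [disjoint U & S] -> (#|U| < L)%N ->
  \sum_(h | maps_to U S h) \prod_(p in S) w #|[set i in U | h i == p]| =
  (#|U|)`!%:R *: (exp_poly w L ^+ #|S|)`_#|U|.
Proof.
have [N] := ubnP #|S|; elim: N S U => // N IH S U.
have [->|[q qS]] := set_0Vmem S.
  move=> _ _ UL; rewrite cards0 expr0 coef1.
  have [->|[i iU]] := set_0Vmem U.
    rewrite cards0 eqxx fact0 scale1r (big_pred1 [ffun i => i]) ?big_set0 // => h.
    apply/maps_toP/eqP => [[_ H]|->]; last by split=> i; rewrite ?inE ?ffunE.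
    by apply/ffunP => i; rewrite ffunE H // inE.
  have -> : (#|U| == 0)%N = false by rewrite (cardD1 i) iU.
  rewrite scaler0 big_pred0 // => h; apply/negP => /maps_toP[/(_ i iU)].
  by rewrite inE.
rewrite (cardsD1 q S) qS ltnS => SN dUS UL.
set S' := S :\ q in SN *.
have qU : q \notin U by apply: contraTN qS => qU; rewrite (disjointFr dUS qU).
rewrite (partition_big (fun h : {ffun T -> T} => [set i in U | h i == q])
  (fun V => V \subset U)) /=; last first.
  by move=> h _; apply/subsetP => i; rewrite inE => /andP[].
transitivity (\sum_(V : {set T} | V \subset U)
    w #|V| * ((#|U| - #|V|)`!%:R *: (exp_poly w L ^+ #|S'|)`_(#|U| - #|V|))).
  apply: eq_bigr => V VU.
  have cUV : (#|U| - #|V| = #|U :\: V|)%N by rewrite cardsDS.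
  rewrite cUV -IH //; first last.
  - by rewrite (leq_ltn_trans (subset_leq_card (subsetDl _ _))).
  - by rewrite (disjointWl (subsetDl _ _)) // (disjointWr (subsetDl _ _)).
  (* [f] sends [V] to [q], and [g] undoes this by fixing [V] pointwise: maps with fiber [V] over [q]
     correspond to maps from [U :\: V] to [S :\ q]. *)
  pose f (h : {ffun T -> T}) := [ffun i => if i \in V then q else h i].
  pose g (h : {ffun T -> T}) := [ffun i => if i \in V then i else h i].
  rewrite big_distrr /= (reindex_onto f g) /=; last first.
    move=> h /andP[_ /eqP VE]; apply/ffunP => i; rewrite !ffunE.
    by case iV: (i \in V) => //; move: iV; rewrite -VE inE => /andP[_ /eqP ->].
  have VUi i : i \in V -> i \in U by move/(subsetP VU).
  apply: eq_big => [h|h /andP[/andP[_ /eqP VE] _]].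
    apply/idP/idP => [/andP[/andP[/maps_toP[H1 H2] /eqP VE] /eqP gf]|/maps_toP[H1 H2]].
      apply/maps_toP; split=> i; rewrite inE ?negb_and ?negbK.
        move=> /andP[iV iU]; have := H1 i iU; rewrite ffunE (negbTE iV) => hS.
        rewrite inE hS andbT inE; apply: contra iV => hq; rewrite -VE inE iU.
        by rewrite ffunE /=; case: ifP; rewrite ?eqxx.
      case/orP => [iV|iU]; first by rewrite -gf ffunE iV.
      have := H2 i iU; rewrite ffunE; case: ifP => // /VUi.
      by rewrite (negbTE iU).
    have HV i : i \in V -> h i = i by move=> iV; apply: H2; rewrite inE iV.
    apply/andP; split; [apply/andP; split|].
    + apply/maps_toP; split=> i iU; rewrite ffunE.
        case: ifP => // iV; have /H1 : i \in U :\: V by rewrite inE iV.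
        by rewrite inE => /andP[].
      have iV : i \notin V by apply: contra iU => /VUi.
      by rewrite (negbTE iV) H2 // inE (negbTE iU) andbF.
    + apply/eqP/setP => i; rewrite inE ffunE.
      case: ifP => [/VUi->|iV]; first by rewrite eqxx.
      apply/negbTE; rewrite negb_and; have [iU|//] := boolP (i \in U).
      have /H1 : i \in U :\: V by rewrite inE iV.
      by rewrite /S' !inE => /andP[].
    + by apply/eqP/ffunP => i; rewrite !ffunE; case iV: (i \in V) => //; rewrite HV.
  rewrite (big_setD1 q) //= VE; congr (_ * _).
  apply: eq_bigr => p; rewrite inE => /andP[]; rewrite inE => pq pS.
  congr (w _); apply: eq_card => i; rewrite !inE ffunE.
  case: ifP => iV /=; last by [].
  by rewrite eq_sym (negbTE pq) andbF.
rewrite (sum_subsets U (fun j => w j * ((#|U| - j)`!%:R *: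
  (exp_poly w L ^+ #|S'|)`_(#|U| - j)))).
rewrite exprS coefM scaler_sumr; apply: eq_bigr => j _.
have jU : (j <= #|U|)%N by rewrite -ltnS.
rewrite coef_poly (leq_ltn_trans jU UL) -scalerAl -scalerAr !scalerA.
by rewrite natr_bin_fact.
Qed.
End FiberSum.

Section PointedPartitionSum.
Variables (k : fieldType) (A : comAlgType k).
Hypothesis k0 : [pchar k] =i pred0.

Lemma maps_toC_idem n (S : {set 'I_n}) (h : {ffun 'I_n -> 'I_n}) i :
  maps_to (~: S) S h -> h (h i) = h i.
Proof.
move=> /maps_toP[H1 H2]; have [/H1 hS|iS] := boolP (i \in ~: S); last by rewrite H2 ?H2.
by apply: H2; rewrite inE negbK.
Qed.

Lemma points_maps_toC n (S : {set 'I_n}) (h : {ffun 'I_n -> 'I_n}) :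
  maps_to (~: S) S h -> points (pp_fun h) = S.
Proof.
move=> hS; have hK i := maps_toC_idem i hS; have [H1 H2] := maps_toP _ _ _ hS.
apply/setP => i; rewrite point_pt pt_pp_fun //; apply/eqP/idP => [hi|iS].
  by apply: contraT; rewrite -in_setC => /[dup] /H1; rewrite hi inE => ->.
by apply: H2; rewrite inE negbK.
Qed.

(** An idempotent map with fixed point set [S] is an arbitrary map from the complement of [S] to
    [S]. *)
Lemma sum_points n (F : ppart n -> A) (S : {set 'I_n}) :
  \sum_(x | points x == S) F x = \sum_(h | maps_to (~: S) S h) F (pp_fun h).
Proof.
rewrite (reindex_onto (fun h : {ffun 'I_n -> 'I_n} => pp_fun h) (fun x => [ffun i => pt x i])).
  apply: eq_bigl => h; apply/idP/idP => [/andP[/eqP <- /eqP hE]|hS].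
    apply/maps_toP; split=> i; rewrite inE.
      by rewrite -{2}hE ffunE pt_point.
    by rewrite negbK point_pt -{2}hE ffunE => /eqP.
  apply/andP; split; first exact/eqP/points_maps_toC.
  by apply/eqP/ffunP => i; rewrite ffunE pt_pp_fun // => j; apply: maps_toC_idem hS.
by move=> x _; apply: pp_fun_eq => i; rewrite ffunE.
Qed.

(** Group by the point set S, which must contain [ord0]: there are C(m, v) such sets of size v+1. A
    block consists of its point and the fiber over it in the complement of S, hence the shift in
    [a j.+1]. *)
Lemma sum_pointed_partitions m (a b : nat -> A) :
  \sum_(x | (x <= pp_top m)%O)
    (\prod_(p in points x) a #|[set q | pt x q == p]|) * b #|points x| =
  \sum_(v < m.+1) ('C(m, v)%:R * (m - v)`!%:R : k) *:
    ((exp_poly (fun j => a j.+1) m.+1 ^+ v.+1)`_(m - v) * b v.+1).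
Proof.
rewrite (partition_big (@points m.+1) (fun S => ord0 \in S)) /=; last first.
  by move=> x; rewrite le_top_pt point_pt.
pose W := exp_poly (fun j => a j.+1) m.+1.
transitivity (\sum_(S : {set 'I_m.+1} | ord0 \in S)
    ((#|~: S|)`!%:R *: (W ^+ #|S|)`_#|~: S|) * b #|S|).
  apply: eq_bigr => S S0.
  transitivity (\sum_(x | points x == S)
      (\prod_(p in points x) a #|[set q | pt x q == p]|) * b #|points x|).
    by apply: eq_bigl => x; rewrite le_top_pt -point_pt; case: eqP => [->|_]; rewrite ?S0 ?andbF.
  rewrite sum_points.
  have dS : [disjoint ~: S & S] by rewrite -setI_eq0 setIC setICr.
  have cS : (#|~: S| < m.+1)%N.
    have e : (#|S| + #|~: S| = m.+1)%N by rewrite cardsC card_ord.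
    apply: leq_trans (eq_leq e); rewrite -add1n leq_add2r card_gt0.
    by apply/set0Pn; exists ord0.
  rewrite -(sum_maps_to k0 _ dS cS) big_distrl /=; apply: eq_bigr => h hS.
  have hK i := maps_toC_idem i hS; have [H1 H2] := maps_toP _ _ _ hS.
  rewrite (points_maps_toC hS).
  congr (_ * _); apply: eq_bigr => p pS; congr a.
  rewrite (cardsD1 p) inE pt_pp_fun // H2 ?inE ?negbK // eqxx add1n; congr _.+1.
  apply: eq_card => i; rewrite !inE pt_pp_fun //.
  have [iS|iS] := boolP (i \in S); last by have /negbTE-> : i != p by apply: contraNneq iS => ->.
  by rewrite H2 ?inE ?negbK // andNb.
rewrite (reindex_onto (fun V => ord0 |: V) (fun S => S :\ ord0)) /=; last first.
  by move=> S S0; rewrite setD1K.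
transitivity (\sum_(V : {set 'I_m.+1} | V \subset [set~ ord0])
    ((m - #|V|)`!%:R *: (W ^+ #|V|.+1)`_(m - #|V|)) * b #|V|.+1).
  apply: eq_big => [V|V /andP[_ /eqP VE]].
    rewrite setU11 /= subsetC sub1set inE.
    apply/eqP/idP => [<-|V0]; first by rewrite !inE eqxx.
    by rewrite setU1K.
  have V0 : ord0 \notin V by rewrite -VE !inE eqxx.
  rewrite cardsU1 V0 add1n.
  by have -> : #|~: (ord0 |: V)| = (m - #|V|)%N by rewrite cardsCs setCK card_ord cardsU1 V0.
rewrite (sum_subsets [set~ ord0] (fun v => ((m - v)`!%:R *: (W ^+ v.+1)`_(m - v)) * b v.+1)).
rewrite cardsC1 card_ord /=; apply: eq_bigr => v _.
by rewrite -scalerAl scalerA.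
Qed.

(** The inner series is x W(x), with W the [exp_poly], so the coefficient of x^(m+1) in its power
    v+1 is that of x^(m-v) in W^(v+1); the scalar is m!/v! = C(m, v) (m-v)!. *)
Lemma series_comp_exp m (a b : nat -> A) :
  m`!%:R *: series_comp (gen_series b) (gen_series a) m.+1 =
  \sum_(v < m.+1) ('C(m, v)%:R * (m - v)`!%:R : k) *:
    ((exp_poly (fun j => a j.+1) m.+1 ^+ v.+1)`_(m - v) * b v.+1).
Proof.
have PE : \poly_(i < m.+2) gen_series a i = 'X * exp_poly (fun j => a j.+1) m.+1.
  apply/polyP => i; rewrite coefXM !coef_poly; case: i => [|i] //=.
rewrite /series_comp PE poly_def linear_sum coef_sum /= scaler_sumr.
rewrite big_ord_recl /= scale0r comp_poly0 coef0 scaler0 add0r.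
apply: eq_bigr => v _; rewrite comp_polyZ comp_Xn_poly coefZ exprMn coefXnM.
rewrite /bump /= add1n ltnNge ltnS subSS.
have vm : (v <= m)%N by rewrite -ltnS.
by rewrite vm natr_bin_fact //= add0n -scalerAl scalerA [b _ * _]mulrC.
Qed.
End PointedPartitionSum.

(** * Transport of structure *)

Lemma eq_lin_ext (k : fieldType) (M : conomType) (V : lmodType k) (h h' : M -> V) u :
  h =1 h' -> lin_ext h u = lin_ext h' u.
Proof. by move=> e; apply: eq_bigr => m _; rewrite e. Qed.

Lemma tens_map_tens (k : fieldType) (M N M' N' : conomType)
    (f : {malg k[M]} -> {malg k[M']}) (g : {malg k[N]} -> {malg k[N']}) u v :
  linear f -> linear g -> tens_map f g (tens u v) = tens (f u) (g v).
Proof.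
move=> fl gl; rewrite -!/(tensl _ _).
apply: (lin_on_basis (f := fun u => tens_map f g (tensl v u))
  (g := fun u => tensl (g v) (f u))) u => [c x y|c x y|m]; rewrite ?fl ?linearP //.
rewrite /tensl; apply: (lin_on_basis (f := fun v => tens_map f g (tens (mbas k m) v))
  (g := fun v => tens (f (mbas k m)) (g v))) v => [c x y|c x y|n]; rewrite ?gl ?linearP //.
by rewrite tens_bas tens_map_bas.
Qed.

Section Transport.
Variables (k : fieldType) (M N : conomType) (f : M -> N) (g : N -> M).
Hypotheses (fK : cancel f g) (gK : cancel g f).
Hypotheses (f1 : f mone = mone) (fM : forall x y, f (mmul x y) = mmul (f x) (f y)).
Local Notation bas := (@mbas k _).

Definition relabel : {malg k[M]} -> {malg k[N]} := lin_ext (fun m => bas (f m)).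
Definition relabel_inv : {malg k[N]} -> {malg k[M]} := lin_ext (fun m => bas (g m)).
HB.instance Definition _ := GRing.Linear.copy relabel (lin_ext _).
HB.instance Definition _ := GRing.Linear.copy relabel_inv (lin_ext _).
Local Notation F := relabel.

Lemma relabel_bas m : F (bas m) = bas (f m).
Proof. exact: lin_ext_bas. Qed.

Lemma relabel_inv_bas m : relabel_inv (bas m) = bas (g m).
Proof. exact: lin_ext_bas. Qed.

Lemma relabelK : cancel F relabel_inv.
Proof.
apply: (lin_on_basis (f := fun u => relabel_inv (F u)) (g := id)) => [c u v|//|m].
  by rewrite !linearP.
by rewrite relabel_bas relabel_inv_bas fK.
Qed.

Lemma relabel_invK : cancel relabel_inv F.
Proof.
apply: (lin_on_basis (f := fun u => F (relabel_inv u)) (g := id)) => [c u v|//|m].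
  by rewrite !linearP.
by rewrite relabel_inv_bas relabel_bas gK.
Qed.

Lemma relabel_morphism : algebra_morphism F.
Proof. by apply: lin_ext_morphism => [|x y]; rewrite ?f1 // fM basM. Qed.

Lemma relabel_scalar c : F c%:MP = c%:MP.
Proof.
have [_ [F1 _]] := relabel_morphism.
by rewrite -[c%:MP]mulr1 mul_malgC linearZ /= F1 -mul_malgC mulr1.
Qed.

Lemma tens_map_relabel x : tens_map F F (bas x) = bas (f x.1, f x.2).
Proof. by rewrite tens_map_bas !relabel_bas tens_bas. Qed.

Lemma tens_map_relabel_morphism : algebra_morphism (tens_map F F).
Proof.
have h : tens_map F F =1 lin_ext (fun x => bas (f x.1, f x.2)).
  apply: (lin_on_basis (f := tens_map F F) (g := lin_ext _)) => [c x y|c x y|x].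
  - by rewrite linearP.
  - by rewrite linearP.
  by rewrite tens_map_relabel lin_ext_bas.
have [_ [h1 hM]] : algebra_morphism (lin_ext (fun x : M * M => bas (f x.1, f x.2))).
  apply: lin_ext_morphism => [|x y]; first by rewrite !f1.
  by rewrite basM /= !fM.
split=> [c x y|]; first by rewrite linearP.
by split=> [|x y]; rewrite !h.
Qed.

Lemma tens_map_comp_relabel (M' N' : conomType) (p : {malg k[N]} -> {malg k[M']})
    (q : {malg k[N]} -> {malg k[N']}) w :
  tens_map p q (tens_map F F w) = tens_map (p \o F) (q \o F) w.
Proof.
apply: (lin_on_basis (f := fun w => tens_map p q (tens_map F F w))
  (g := tens_map (p \o F) (q \o F))) w => [c u v|c u v|x]; rewrite ?linearP //.
by rewrite tens_map_relabel !tens_map_bas /= !relabel_bas.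
Qed.

Lemma tens_mul_comp_relabel (p q : {malg k[N]} -> {malg k[N]}) w :
  tens_mul p q (tens_map F F w) = lin_ext (fun x => p (F (bas x.1)) * q (F (bas x.2))) w.
Proof.
apply: (lin_on_basis (f := fun w => tens_mul p q (tens_map F F w))
  (g := lin_ext _)) w => [c u v|c u v|x]; rewrite ?linearP //.
by rewrite tens_map_relabel tens_mul_bas lin_ext_bas !relabel_bas.
Qed.

Lemma relabel_tens_mul (p q : {malg k[M]} -> {malg k[M]}) w :
  F (tens_mul p q w) = lin_ext (fun x => F (p (bas x.1)) * F (q (bas x.2))) w.
Proof.
have [_ [_ FMul]] := relabel_morphism.
apply: (lin_on_basis (f := fun w => F (tens_mul p q w))
  (g := lin_ext _)) w => [c u v|c u v|x]; rewrite ?linearP //.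
by rewrite tens_mul_bas lin_ext_bas FMul.
Qed.

Lemma tens_assoc_relabel w :
  tens_assoc (tens_map (tens_map F F) F w) = tens_map F (tens_map F F) (tens_assoc w).
Proof.
apply: (lin_on_basis (f := fun w => tens_assoc (tens_map (tens_map F F) F w))
  (g := fun w => tens_map F (tens_map F F) (tens_assoc w))) w => [c u v|c u v|x].
- by rewrite !linearP.
- by rewrite !linearP.
rewrite tens_map_bas tens_map_relabel relabel_bas tens_bas !tens_assoc_bas.
by rewrite tens_map_bas tens_map_relabel relabel_bas tens_bas.
Qed.

Variables (DM : {malg k[M]} -> {malg k[(M * M)%type]}) (epsM : {malg k[M]} -> k).
Variables (DN : {malg k[N]} -> {malg k[(N * N)%type]}) (epsN : {malg k[N]} -> k).
Hypotheses (FD : forall u, DN (F u) = tens_map F F (DM u)).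
Hypothesis Feps : forall u, epsN (F u) = epsM u.
Hypotheses (DN_morph : algebra_morphism DN) (epsN_morph : algebra_morphism (epsN : _ -> k^o)).
Hypothesis HM : is_Hopf_algebra DM epsM.

(** [DN] is the conjugate of [DM] by the bijection [F], so coassociativity and the counit laws are
    images of those on [M], and the antipode is the conjugate of [S]. *)
Lemma relabel_is_Hopf : is_Hopf_algebra DN epsN.
Proof.
case: HM => -[DMl _] _ coass counitl counitr [S [Sl SL SR]].
have DNE u : DN u = tens_map F F (DM (relabel_inv u)) by rewrite -FD relabel_invK.
have epsE u : epsM (relabel_inv u) = epsN u by rewrite -Feps relabel_invK.
split=> // [u|u|u|].
- rewrite !DNE; set w := DM _; rewrite !tens_map_comp_relabel.
  transitivity (tens_assoc (tens_map (tens_map F F) F (tens_map DM id w))).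
    congr tens_assoc.
    apply: (lin_on_basis (f := tens_map (DN \o F) (id \o F))
      (g := fun w => tens_map (tens_map F F) F (tens_map DM id w))) w => [c v z|c v z|x].
    + by rewrite linearP.
    + by rewrite !linearP.
    rewrite !tens_map_bas /= FD tens_map_tens //; exact: lin_ext_is_linear.
  rewrite tens_assoc_relabel coass.
  apply: (lin_on_basis (g := tens_map (id \o F) (DN \o F))
      (f := fun w => tens_map F (tens_map F F) (tens_map id DM w))) w => [c v z|c v z|x].
  + by rewrite !linearP.
  + by rewrite linearP.
  by rewrite !tens_map_bas /= FD tens_map_tens //; exact: lin_ext_is_linear.
- transitivity (F (tens_mul (fun v => (epsM v)%:MP) id (DM (relabel_inv u)))); last first.
    by rewrite counitl relabel_invK.
  rewrite DNE tens_mul_comp_relabel relabel_tens_mul; apply: eq_lin_ext => x.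
  by rewrite relabel_scalar Feps.
- transitivity (F (tens_mul id (fun v => (epsM v)%:MP) (DM (relabel_inv u)))); last first.
    by rewrite counitr relabel_invK.
  rewrite DNE tens_mul_comp_relabel relabel_tens_mul; apply: eq_lin_ext => x.
  by rewrite relabel_scalar Feps.
exists (fun u => F (S (relabel_inv u))); split=> [c u v|u|u].
- by rewrite linearP Sl linearP.
- transitivity (F (tens_mul S id (DM (relabel_inv u)))); last by rewrite SL relabel_scalar epsE.
  rewrite DNE tens_mul_comp_relabel relabel_tens_mul; apply: eq_lin_ext => x.
  by rewrite relabelK.
- transitivity (F (tens_mul id S (DM (relabel_inv u)))); last by rewrite SR relabel_scalar epsE.
  rewrite DNE tens_mul_comp_relabel relabel_tens_mul; apply: eq_lin_ext => x.
  by rewrite relabelK.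
Qed.

Lemma relabel_is_Hopf_isomorphism : is_Hopf_isomorphism DM epsM DN epsN F.
Proof.
split=> //; first exact: relabel_morphism.
by exists relabel_inv; [exact: relabelK|exact: relabel_invK].
Qed.
End Transport.

(** * Comparison of the two coproducts *)

Section Comparison.
Variable k : fieldType.
Hypothesis k0 : [pchar k] =i pred0.
Local Notation mon := {cmonom gen_index}.
Local Notation bas := (@mbas k _).
Local Notation F := (@relabel k _ _ expo).

Lemma morphism_prod (A B : algType k) (h : A -> B) (I : finType) (P : pred I) (G : I -> A) :
  algebra_morphism h -> h (\prod_(i | P i) G i) = \prod_(i | P i) h (G i).
Proof. by move=> [_ [h1 hM]]; apply: big_morph. Qed.

Lemma gen_bas n : gen k n = bas (mgen n).
Proof. exact: mgenE. Qed.

Lemma bas_prod (M : conomType) (I : finType) (P : pred I) (h : I -> M) :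
  bas (\big[mmul/mone]_(i | P i) h i) = \prod_(i | P i) bas (h i).
Proof. by apply: (big_morph (@mbas k M)) => [x y|//]; rewrite basM. Qed.

Lemma mul_pairE (x y : mon * mon) : mmul x y = (mmul x.1 y.1, mmul x.2 y.2).
Proof. by []. Qed.

(** By [icls_bot], [0, x] depends only on the block sizes of x; by [icls_top], [x, 1] depends only
    on the number of blocks. Singleton blocks contribute a_1 = 1. *)
Lemma tens_map_inc_comul_pic n :
  tens_map F F (inc_comul (bas (pic n))) =
  \sum_(x | (x <= pp_top n)%O)
    (\prod_(p in points x) tens (gen k #|[set q | pt x q == p]|) 1) *
    tens 1 (gen k #|points x|).
Proof.
rewrite inc_comul_icls ?le_bot // (linear_sum (tens_map F F)).
apply: eq_big => [x|x /andP[_ xt]]; first by rewrite le_bot.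
rewrite /= tens_map_relabel /= (icls_top xt) icls_bot.
have pos (S : {set 'I_n.+1}) i : i \in S -> #|S|.-1.+1 = #|S|.
  by move=> iS; rewrite prednK // card_gt0; apply/set0Pn; exists i.
rewrite expo_pic (pos _ (pt x ord0)) ?pt_point // (big_morph expo expoM expo1).
rewrite gen_bas -bas1 tens_bas.
rewrite (eq_bigr (fun p => mgen #|[set q | pt x q == p]|)); last first.
  by move=> p px; rewrite expo_pic (pos _ p) // inE -point_pt.
rewrite (eq_bigr (fun p => bas (mgen #|[set q | pt x q == p]|, mone : mon))); last first.
  by move=> p _; rewrite gen_bas tens_bas.
rewrite -bas_prod basM; congr mbas.
have pairM : {morph (fun y : mon => (y, mone : mon)) : y z / mmul y z >-> mmul y z}.
  by move=> y z; rewrite mul_pairE /= mulm1.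
by rewrite -(big_morph _ pairM (erefl : _ = mone)) mul_pairE /= mulm1 mul1m.
Qed.

(** Both sides are multiplicative, so [icls_pic] reduces the claim to the classes [pic m]. There
    both equal the sum over v common to [sum_pointed_partitions] and [series_comp_exp]. *)
Lemma comp_comul_relabel u : comp_comul (F u) = tens_map F F (inc_comul u).
Proof.
have [cl _] := comp_comul_morphism k.
apply: (lin_on_basis (f := fun u => comp_comul (F u))
  (g := fun u => tens_map F F (inc_comul u))) u => [c x y|c x y|c].
- by rewrite linearP cl.
- by rewrite !linearP.
elim/icls_ind: c => n a b ab; rewrite icls_pic // relabel_bas.
rewrite (big_morph expo expoM expo1) !bas_prod.
rewrite (morphism_prod _ _ (comp_comul_morphism k)).
rewrite (morphism_prod _ _ (inc_comul_morphism k)).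
rewrite (morphism_prod _ _ (tens_map_relabel_morphism k expo1 expoM)).
apply: eq_bigr => p _.
move: (_.-1) => m; rewrite expo_pic -gen_bas tens_map_inc_comul_pic.
(* Unlike [comp_comul_gen], the series identity also covers m = 0, where [gen] is 1; m! is
   invertible in characteristic 0. *)
have -> : comp_comul (gen k m.+1) = m`!%:R *: series_comp (F2 k) (F1 k) m.+1.
  by rewrite -(comp_comul_series k0) scalerA divff ?scale1r ?natr_fact_neq0.
rewrite (sum_pointed_partitions k0 m (fun j => tens (gen k j) 1) (fun j => tens 1 (gen k j))).
exact: series_comp_exp.
Qed.

Lemma comp_counit_relabel u : comp_counit (F u) = inc_counit u.
Proof.
apply: (lin_on_basis (V := k^o) (f := fun u => comp_counit (F u)) (g := @inc_counit k)) u
  => [c u v|c u v|c].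
- by rewrite linearP; apply: lin_ext_is_linear.
- exact: lin_ext_is_linear.
rewrite relabel_bas /comp_counit /inc_counit !lin_ext_bas; congr (_ %:R).
by rewrite -expo1 (can_eq thetaK).
Qed.
End Comparison.

Theorem theorem1p20 (k : fieldType) (char0 : [pchar k]%R =i pred0) :
  [/\ is_Hopf_algebra (@inc_comul k) (@inc_counit k),
      is_Hopf_algebra (@comp_comul k) (@comp_counit k)
    & exists f : {malg k[iclass]} -> {malg k[{cmonom gen_index}]},
        is_Hopf_isomorphism (@inc_comul k) (@inc_counit k)
                            (@comp_comul k) (@comp_counit k) f].
Proof.
have FD := comp_comul_relabel char0; have Feps := @comp_counit_relabel k.
split; first exact: inc_is_Hopf.
  exact: (relabel_is_Hopf thetaK expoK expo1 expoM FD Feps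
    (comp_comul_morphism k) (counit_is_morphism k _) (inc_is_Hopf k)).
exists (relabel expo).
exact: (relabel_is_Hopf_isomorphism thetaK expoK expo1 expoM FD Feps).
Qed.
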